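(* Let $n$ be a fixed odd number, let $c=\{c_k\}_{k\ge0}$ be a non-decreasing sequence of real numbers with $c_0=1$, and let $b_k:=\frac{c_{k+n-1}(k!)^2}{[(n+k-1)!]^2}$ for $k\ge0$. Then the Fueter-Sce map from $\mathcal{HS}(\Omega_c)$ to $\mathcal{HM}(\Omega_b)$ is surjective, i.e. $$\Delta_{\mathbb{R}^{n+1}}^{\frac{n-1}{2}}\left(\mathcal{HS}(\Omega_c)\right)=\mathcal{HM}(\Omega_b).$$
   Context: $\mathbb{R}_n$ is the real Clifford algebra generated by $e_1,\dots,e_n$ with $e_\ell e_m+e_me_\ell=0$ for $\ell\ne m$ and $e_\ell^2=-1$; for $a=\sum_A a_Ae_A$, $|a|=(\sum_A a_A^2)^{1/2}$. A point $(x_0,\dots,x_n)\in\mathbb{R}^{n+1}$ is identified with the paravector $x=x_0+\underline{x}$, $\underline{x}=\sum_{\ell=1}^n x_\ell e_\ell$; $\bar x=x_0-\underline{x}$. $\Delta_{\mathbb{R}^{n+1}}=\sum_{i=0}^n\partial_{x_i}^2$; the Fueter-Sce map is the operator $\Delta_{\mathbb{R}^{n+1}}^{(n-1)/2}$. The Clifford-Appell polynomials are $$P_k^n(x):=\sum_{s=0}^k T_s^k(n)\,x^{k-s}\bar x^{s},\qquad T_s^k(n):=\binom{k}{s}\frac{\left(\frac{n+1}{2}\right)_{k-s}\left(\frac{n-1}{2}\right)_s}{(n)_k},$$ where $(a)_0=1$ and $(a)_s=a(a+1)\cdots(a+s-1)$ for $s>0$. For a sequence $d=\{d_k\}_{k\ge0}$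 of positive reals put $\Omega_d:=\{x\in\mathbb{R}^{n+1}:\sum_{k\ge0}|x|^{2k}/d_k<\infty\}$. Define $$\mathcal{HS}(\Omega_c):=\Big\{\sum_{k=0}^\infty x^k\beta_k:\ \beta_k\in\mathbb{R}_n,\ \sum_{k=0}^\infty c_k|\beta_k|^2<\infty\Big\},\qquad \mathcal{HM}(\Omega_b):=\Big\{\sum_{k=0}^\infty P_k^n(x)\alpha_k:\ \alpha_k\in\mathbb{R}_n,\ \sum_{k=0}^\infty b_k|\alpha_k|^2<\infty\Big\},$$ as functions on $\Omega_c$, respectively $\Omega_b$. The function $\Delta_{\mathbb{R}^{n+1}}^{(n-1)/2}f$ is computed at interior points, and an element of $\mathcal{HM}(\Omega_b)$ is identified with its restriction to the interior of $\Omega_b$. *)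

(* Defs.v *)
From HB Require Import structures.
From mathcomp Require Import all_boot all_order all_algebra.
From mathcomp Require Import all_classical all_reals all_analysis.
From mathcomp Require Import ring lra.

Set Implicit Arguments.
Unset Strict Implicit.
Unset Printing Implicit Defensive.

Import Order.TTheory GRing.Theory Num.Theory.
Import numFieldNormedType.Exports.

Local Open Scope classical_set_scope.
Local Open Scope ring_scope.

Section BladeSign.
Variable n : nat.
Implicit Types A B C : {set 'I_n}.

Definition symdiff A B : {set 'I_n} :=
  finset (fun i => (i \in A) (+) (i \in B)).

(* For e_A the increasing product of the e_i with i in A, one has
   e_A e_B = blade_sign A B * e_(symdiff A B): each pair i in A, j in B with
   j < i costs one transposition, and each i = j contributes e_i ^ 2 = -1. *)
Definition blade_sign (R : pzRingType) A B : R :=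
  (-1) ^+ #|finset (fun p : 'I_n * 'I_n =>
              [&& p.1 \in A, p.2 \in B & p.2 <= p.1]%N)|.

Lemma symdiffC A B : symdiff A B = symdiff B A.
Proof. by apply/setP => i; rewrite !inE addbC. Qed.

Lemma symdiffA A B C : symdiff A (symdiff B C) = symdiff (symdiff A B) C.
Proof. by apply/setP => i; rewrite !inE addbA. Qed.

Lemma symdiffK A : involutive (symdiff A).
Proof. by move=> B; apply/setP => i; rewrite !inE addbA addbb. Qed.

Lemma symdiff0 A : symdiff A finset.set0 = A.
Proof. by apply/setP => i; rewrite !inE addbF. Qed.

Lemma symdiffv A : symdiff A A = finset.set0.
Proof. by apply/setP => i; rewrite !inE addbb. Qed.

Variable R : comPzRingType.
Local Notation sgn := (blade_sign R).

Lemma blade_signE A B : sgn A B =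
  \prod_(p : 'I_n * 'I_n)
    (-1) ^+ [&& p.1 \in A, p.2 \in B & p.2 <= p.1]%N.
Proof.
rewrite /blade_sign -prodr_const big_mkcond; apply: eq_bigr => p _.
by rewrite inE; case: ifP.
Qed.

Lemma blade_signDl A B C : sgn (symdiff A B) C = sgn A C * sgn B C.
Proof.
rewrite !blade_signE -big_split; apply: eq_bigr => p _ /=.
by rewrite -signr_addb inE andb_addl.
Qed.

Lemma blade_signDr A B C : sgn A (symdiff B C) = sgn A B * sgn A C.
Proof.
rewrite !blade_signE -big_split; apply: eq_bigr => p _ /=.
by rewrite -signr_addb inE andb_addl andb_addr.
Qed.

Lemma blade_sign0l A : sgn finset.set0 A = 1.
Proof. by rewrite blade_signE big1 // => p _; rewrite inE. Qed.

Lemma blade_sign0r A : sgn A finset.set0 = 1.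
Proof. by rewrite blade_signE big1 // => p _; rewrite inE andbF. Qed.

End BladeSign.

(* a : clifford R n is the family of its coefficients a_A on the basis e_A. *)
Definition clifford (R : Type) (n : nat) : Type := {ffun {set 'I_n} -> R}.

HB.instance Definition _ (R : realType) n :=
  GRing.Lmodule.copy (clifford R n) {ffun {set 'I_n} -> R^o}.

Section Clifford.
Variables (R : realType) (n : nat).
Implicit Types (a b c : clifford R n) (A B C : {set 'I_n}).

Definition blade A : clifford R n := [ffun B => (A == B)%:R].

Definition clifford_mul a b : clifford R n :=
  [ffun C => \sum_A blade_sign R A (symdiff A C) * (a A * b (symdiff A C))].

Fact clifford_mulA : associative clifford_mul.
Proof.
move=> a b c; apply/ffunP => D; rewrite !ffunE.
under [RHS]eq_bigr do rewrite ffunE mulr_suml mulr_sumr.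
rewrite exchange_big /=; apply: eq_bigr => A _.
rewrite ffunE !mulr_sumr (reindex_inj (inv_inj (symdiffK A))) /=.
apply: eq_bigr => E _.
have -> : symdiff (symdiff A E) (symdiff A D) = symdiff E D.
  by rewrite (symdiffC A E) -symdiffA symdiffK.
rewrite !blade_signDl !blade_signDr.
have ssq (X Y : {set 'I_n}) : blade_sign R X Y * blade_sign R X Y = 1.
  by rewrite -blade_signDr symdiffv blade_sign0r.
rewrite -[RHS]mulr1 -(ssq A D); ring.
Qed.

Fact clifford_mul1l : left_id (blade finset.set0) clifford_mul.
Proof.
move=> a; apply/ffunP => C; rewrite ffunE (bigD1 finset.set0) //=.
rewrite big1 => [|A A0]; last by rewrite ffunE eq_sym (negbTE A0) mul0r mulr0.
by rewrite addr0 ffunE eqxx blade_sign0l (symdiffC finset.set0) symdiff0 !mul1r.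
Qed.

Fact clifford_mul1r : right_id (blade finset.set0) clifford_mul.
Proof.
move=> a; apply/ffunP => C; rewrite ffunE (bigD1 C) //= symdiffv.
rewrite big1 => [|A AC].
  by rewrite addr0 ffunE eqxx blade_sign0r mul1r mulr1.
rewrite ffunE; case: eqP => [e|]; last by rewrite mulr0 mulr0.
by move: AC; rewrite -(symdiffK A C) -e symdiff0 eqxx.
Qed.

Fact clifford_mulDl : left_distributive clifford_mul +%R.
Proof.
move=> a b c; apply/ffunP => C; rewrite !ffunE -big_split /=.
by apply: eq_bigr => A _; rewrite ffunE mulrDl mulrDr.
Qed.

Fact clifford_mulDr : right_distributive clifford_mul +%R.
Proof.
move=> a b c; apply/ffunP => C; rewrite !ffunE -big_split /=.
by apply: eq_bigr => A _; rewrite ffunE !mulrDr.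
Qed.

Fact clifford1_neq0 : blade finset.set0 != 0.
Proof.
by apply/eqP => /ffunP /(_ finset.set0) /eqP; rewrite !ffunE eqxx oner_eq0.
Qed.

HB.instance Definition _ := GRing.Zmodule_isNzRing.Build (clifford R n)
  clifford_mulA clifford_mul1l clifford_mul1r clifford_mulDl clifford_mulDr
  clifford1_neq0.

Lemma clifford_mulE a b C :
  (a * b) C = \sum_A blade_sign R A (symdiff A C) * (a A * b (symdiff A C)).
Proof. by rewrite [a * b]/(clifford_mul a b) ffunE. Qed.

Fact clifford_scalerAl (k : R) a b : k *: (a * b) = k *: a * b.
Proof.
apply/ffunP => C; rewrite ffunE !clifford_mulE scaler_sumr.
by apply: eq_bigr => A _; rewrite ffunE /GRing.scale /=; ring.
Qed.

Fact clifford_scalerAr (k : R) a b : k *: (a * b) = a * (k *: b).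
Proof.
apply/ffunP => C; rewrite ffunE !clifford_mulE scaler_sumr.
by apply: eq_bigr => A _; rewrite ffunE /GRing.scale /=; ring.
Qed.

HB.instance Definition _ :=
  GRing.Lmodule_isLalgebra.Build R (clifford R n) clifford_scalerAl.
HB.instance Definition _ :=
  GRing.Lalgebra_isAlgebra.Build R (clifford R n) clifford_scalerAr.

Definition clifford_norm a : R := Num.sqrt (\sum_A a A ^+ 2).

Fact clifford_norm0 a : clifford_norm a = 0 -> a = 0.
Proof.
move=> /eqP; rewrite sqrtr_eq0 => le0; apply/ffunP => A; rewrite ffunE.
apply/eqP; rewrite -sqrf_eq0; apply/eqP.
have ge0 B : true -> 0 <= a B ^+ 2 by rewrite sqr_ge0.
apply: (psumr_eq0P ge0) => //.
by apply/le_anti; rewrite le0 sumr_ge0.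
Qed.

Fact clifford_normZ (k : R) a : clifford_norm (k *: a) = `|k| * clifford_norm a.
Proof.
rewrite /clifford_norm -sqrtr_sqr -sqrtrM ?sqr_ge0 // mulr_sumr.
by congr Num.sqrt; apply: eq_bigr => A _; rewrite ffunE exprMn.
Qed.

Fact clifford_normD a b :
  clifford_norm (a + b) <= clifford_norm a + clifford_norm b.
Proof.
have sq_ge0 c : 0 <= \sum_A c A ^+ 2 by apply: sumr_ge0 => A _; exact: sqr_ge0.
have norm_ge0 c : 0 <= clifford_norm c by exact: sqrtr_ge0.
have [/clifford_norm0 ->|a0] := eqVneq (clifford_norm a) 0.
  by rewrite add0r lerDr.
have [/clifford_norm0 ->|b0] := eqVneq (clifford_norm b) 0.
  by rewrite addr0 lerDl.
set s := clifford_norm a in a0 *; set t := clifford_norm b in b0 *.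
have s0 : 0 < s by rewrite lt_def a0 norm_ge0.
have t0 : 0 < t by rewrite lt_def b0 norm_ge0.
have s2 : \sum_A a A ^+ 2 = s ^+ 2 by rewrite sqr_sqrtr.
have t2 : \sum_A b A ^+ 2 = t ^+ 2 by rewrite sqr_sqrtr.
have cs : \sum_A a A * b A <= s * t.
  have : 0 <= \sum_A (t * a A - s * b A) ^+ 2.
    by apply: sumr_ge0 => A _; exact: sqr_ge0.
  have -> : \sum_A (t * a A - s * b A) ^+ 2 =
      t ^+ 2 * (\sum_A a A ^+ 2) + s ^+ 2 * (\sum_A b A ^+ 2)
      - (2 * (s * t)) * (\sum_A a A * b A).
    rewrite !mulr_sumr -sumrN -!big_split /=.
    by apply: eq_bigr => A _; ring.
  rewrite s2 t2 => h.
  have : 0 <= (2 * (s * t)) * (s * t - \sum_A a A * b A).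
    by apply: le_trans h _; rewrite le_eqVlt; apply/orP; left; apply/eqP; ring.
  by rewrite pmulr_rge0 ?subr_ge0 // !mulr_gt0.
rewrite -(ler_pXn2r (ltn0Sn 1)) ?nnegrE ?norm_ge0 ?addr_ge0 ?(ltW s0) ?(ltW t0) //.
rewrite sqr_sqrtr //.
have -> : \sum_A (a + b) A ^+ 2 =
    \sum_A a A ^+ 2 + \sum_A b A ^+ 2 + 2 * (\sum_A a A * b A).
  rewrite mulr_sumr -!big_split /=.
  by apply: eq_bigr => A _; rewrite ffunE; ring.
by rewrite s2 t2; nra.
Qed.

HB.instance Definition _ := Lmodule_isNormed.Build R (clifford R n)
  clifford_normD clifford_normZ clifford_norm0.

Lemma clifford_normE a : `|a| = Num.sqrt (\sum_A a A ^+ 2).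
Proof. by []. Qed.

Lemma bladeM A B :
  blade A * blade B = blade_sign R A B *: blade (symdiff A B).
Proof.
apply/ffunP => C; rewrite clifford_mulE (bigD1 A) //= !ffunE eqxx mul1r.
rewrite big1 ?addr0 => [|E EA]; last first.
  by rewrite ffunE eq_sym (negbTE EA) mul0r mulr0.
rewrite -[symdiff A B == C](inj_eq (inv_inj (symdiffK A))) symdiffK.
by case: eqP => [->|_]; rewrite // !(mulr0, scaler0).
Qed.

Definition generator (i : 'I_n) : clifford R n := blade (finset.set1 i).

Lemma generator_sqr i : generator i * generator i = -1.
Proof.
rewrite bladeM symdiffv blade_signE (bigD1 (i, i)) //= !inE eqxx leqnn expr1.
rewrite big1 ?mulr1 ?scaleN1r // => -[p q] /= pq.
by rewrite !inE; case: eqP => // ep; case: eqP => // eq; move: pq; rewrite ep eq eqxx.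
Qed.

Lemma blade_cons (i : 'I_n) A : (forall j, j \in A -> i < j)%N ->
  generator i * blade A = blade (i |: A)%SET.
Proof.
move=> iA; have -> : (i |: A)%SET = symdiff (finset.set1 i) A.
  apply/setP => j; rewrite !inE; case: eqP => [->|//].
  by case: (boolP (i \in A)) => // /iA; rewrite ltnn.
rewrite bladeM blade_signE big1 ?scale1r // => -[p q] _ /=.
rewrite !inE; case: eqP => //= ->; case: (boolP (q \in A)) => //= /iA.
by rewrite ltnNge => /negbTE ->.
Qed.

Lemma generator_anticomm i j : i != j ->
  generator i * generator j + generator j * generator i = 0.
Proof.
have sg (k l : 'I_n) : blade_sign R (finset.set1 k) (finset.set1 l) =
    (-1) ^+ (l <= k)%N.
  rewrite blade_signE (bigD1 (k, l)) //= !inE !eqxx /= big1 ?mulr1 // => -[p q].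
  by rewrite !inE xpair_eqE /=; case: eqP => //= _ /negbTE ->.
move=> ij; rewrite !bladeM !sg (symdiffC (finset.set1 j)) -scalerDl.
have : (i : nat) != j by [].
by case: ltngtP => // _ _; rewrite ?expr0 ?expr1 ?subrr ?addNr scale0r.
Qed.

Definition paravector (x : 'rV[R]_n.+1) : clifford R n :=
  (x ord0 ord0)%:A + \sum_(l < n) x ord0 (lift ord0 l) *: generator l.

Definition paravector_conj (x : 'rV[R]_n.+1) : clifford R n :=
  (x ord0 ord0)%:A - \sum_(l < n) x ord0 (lift ord0 l) *: generator l.

Definition laplacian (f : 'rV[R]_n.+1 -> clifford R n) :
    'rV[R]_n.+1 -> clifford R n :=
  fun x => \sum_(i < n.+1)
    'D_(delta_mx ord0 i) ('D_(delta_mx ord0 i) f) x.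

(* 'D_v is total; this says that all the second partial derivatives which
   occur in iter m laplacian f exist at every point of D. *)
Definition laplacian_iter_defined (m : nat) (D : set 'rV[R]_n.+1)
    (f : 'rV[R]_n.+1 -> clifford R n) : Prop :=
  forall (j : nat) (i : 'I_n.+1) (x : 'rV[R]_n.+1), (j < m)%N -> D x ->
    derivable (iter j laplacian f) x (delta_mx ord0 i) /\
    derivable ('D_(delta_mx ord0 i) (iter j laplacian f)) x (delta_mx ord0 i).

Definition fueter_sce (f : 'rV[R]_n.+1 -> clifford R n) :
    'rV[R]_n.+1 -> clifford R n := iter (n.-1)./2 laplacian f.

Definition pochhammer (a : R) (s : nat) : R := \prod_(i < s) (a + i%:R).

Definition appell_coef (k s : nat) : R :=
  'C(k, s)%:R * (pochhammer ((n%:R + 1) / 2) (k - s)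
                 * pochhammer ((n%:R - 1) / 2) s) / pochhammer n%:R k.

Definition appell_poly (k : nat) (x : 'rV[R]_n.+1) : clifford R n :=
  \sum_(s < k.+1)
    appell_coef k s *: (paravector x ^+ (k - s) * paravector_conj x ^+ s).

(* |x| is the norm of the paravector: the library norm on 'rV is the sup norm. *)
Definition series_domain (d : nat -> R) : set 'rV[R]_n.+1 :=
  [set x | (\sum_(0 <= k <oo) (`|paravector x| ^+ (2 * k) / d k)%:E < +oo)%E].

Definition weighted_l2 (d : nat -> R) : set (nat -> clifford R n) :=
  [set a | (\sum_(0 <= k <oo) (d k * `|a k| ^+ 2)%:E < +oo)%E].

(* Functions on series_domain d are represented by total functions vanishing
   off it. *)
Definition series_space (p : nat -> 'rV[R]_n.+1 -> clifford R n)
    (d : nat -> R) : set ('rV[R]_n.+1 -> clifford R n) :=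
  [set f | exists2 a, weighted_l2 d a &
     (forall x, series_domain d x -> series (fun k => p k x * a k) @ \oo --> f x)
     /\ (forall x, ~ series_domain d x -> f x = 0)].

Definition HS (c : nat -> R) : set ('rV[R]_n.+1 -> clifford R n) :=
  series_space (fun k x => paravector x ^+ k) c.

Definition HM (b : nat -> R) : set ('rV[R]_n.+1 -> clifford R n) :=
  series_space appell_poly b.

End Clifford.

Arguments series_domain {R} n d.
Arguments HS {R} n c.
Arguments HM {R} n b.

(* Main.v *)
(* Let n = 2h+1 and let q_(m,k) be the coefficient of t^k in
   (1 - t x)^-(m+1) (1 - t xbar)^-m, so that q_(0,k) = x^k and q_(h,k) is a
   positive multiple of P_k^n.  Multiplying by the real polynomial
   W = (1 - t x)(1 - t xbar) lowers m by one; combined with Euler's identity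
   for q_(m,k) and its Appell property for the derivative in x_0, this gives
   Laplacian q_(m,k+2) = -2(m+1)(n-1-2m) q_(m+1,k) by induction on m and k,
   hence Laplacian^h x^(k+2h) is a nonzero multiple of P_k^n.  The multiple is
   exactly what relates the weights b and c, up to a global constant.

   Termwise differentiation rests on |x a| = |x||a| for a paravector x: all
   the derivatives of x^k obey the bounds of the scalar monomial |x|^k, so the
   differentiated series converge on the same open ball, which is the interior
   of both series domains.  In place of the Cauchy-Schwarz inequality,
   |x|^k |a_k| <= |x|^(2k)/d_k + d_k |a_k|^2 is enough. *)
Require Import Defs.
From HB Require Import structures.
From mathcomp Require Import all_boot all_order all_algebra.
From mathcomp Require Import all_classical all_reals all_analysis.
From mathcomp Require Import ring lra.

Set Implicit Arguments.
Unset Strict Implicit.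
Unset Printing Implicit Defensive.

Import Order.TTheory GRing.Theory Num.Theory.
Import numFieldNormedType.Exports.

Local Open Scope classical_set_scope.
Local Open Scope ring_scope.

(** * The Clifford norm *)

Section CliffordNorm.
Variables (R : realType) (n : nat).
Implicit Types (a b : clifford R n) (x y : 'rV[R]_n.+1).

(** ['D_v] is a total operator, so every formula for a derivative also needs derivability. For the
    powers of x this comes from an inductive class of maps closed under ['D_v]. For a series it
    comes from a remainder bound that is quadratic in the step and uniform over the terms, which is
    why each term carries bounds of every order and not only a bound on its size. A derivative costs
    a factor of the order of the degree, and a slightly larger radius pays for it. The same exchange
    gives the two domains one interior: b and c differ by a shift of 2h and a factor polynomial in
    k. Membership in the function spaces concerns the whole domains, boundary points included,
    whereas the Laplacian is computed only inside. Hence two convergence arguments: one pointwise on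
    the domain, one locally uniform on open balls. For surjectivity, Laplacian^h kills x^k for k <
    2h, so the first 2h coefficients of a preimage are free and are set to 0; the others are
    obtained by division. Oddness of n makes h an integer and turns the factors n - 1 - 2i into 2(h
    - i), nonzero for i < h. *)

Definition cdot a b : R := \sum_A a A * b A.

Lemma sqr_norm_cdot a : `|a| ^+ 2 = cdot a a.
Proof.
rewrite clifford_normE sqr_sqrtr //.
by apply: sumr_ge0 => A _; exact: sqr_ge0.
Qed.

Lemma cdotDl a b c : cdot (a + b) c = cdot a c + cdot b c.
Proof.
by rewrite /cdot -big_split; apply: eq_bigr => A _; rewrite ffunE mulrDl.
Qed.

Lemma cdotC a b : cdot a b = cdot b a.
Proof. by apply: eq_bigr => A _; rewrite mulrC. Qed.

Lemma cdotDr a b c : cdot a (b + c) = cdot a b + cdot a c.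
Proof. by rewrite cdotC cdotDl !(cdotC a). Qed.

Lemma cdotZl (k : R) a b : cdot (k *: a) b = k * cdot a b.
Proof. by rewrite mulr_sumr; apply: eq_bigr => A _; rewrite ffunE mulrA. Qed.

Lemma cdotZr (k : R) a b : cdot a (k *: b) = k * cdot a b.
Proof. by rewrite cdotC cdotZl cdotC. Qed.

Lemma cdotNr a b : cdot a (- b) = - cdot a b.
Proof. by rewrite -scaleN1r cdotZr mulN1r. Qed.

Lemma cdot_suml I (r : seq I) (F : I -> clifford R n) b :
  cdot (\sum_(i <- r) F i) b = \sum_(i <- r) cdot (F i) b.
Proof.
elim/big_ind2: _ => // [|u s v t <- <-]; last exact: cdotDl.
by rewrite /cdot big1 // => A _; rewrite ffunE mul0r.
Qed.

Lemma cdot_sumr I (r : seq I) (F : I -> clifford R n) b :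
  cdot b (\sum_(i <- r) F i) = \sum_(i <- r) cdot b (F i).
Proof. by rewrite cdotC cdot_suml; apply: eq_bigr => i _; exact: cdotC. Qed.

Lemma generator_mulE (i : 'I_n) a C : (generator R i * a) C =
  blade_sign R (finset.set1 i) (symdiff (finset.set1 i) C)
    * a (symdiff (finset.set1 i) C).
Proof.
rewrite clifford_mulE (bigD1 (finset.set1 i)) //= big1 => [|A /negbTE Ai].
  by rewrite addr0 ffunE eqxx mul1r.
by rewrite ffunE eq_sym Ai mul0r mulr0.
Qed.

(** Left multiplication by [e_i] permutes the blades up to sign and squares to -1; an isometry with
    square -1 is antisymmetric. *)
Lemma cdot_generatorl (i : 'I_n) a b :
  cdot (generator R i * a) b = - cdot a (generator R i * b).
Proof.
pose s := finset.set1 i.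
have ss : blade_sign R s s = -1.
  rewrite blade_signE (bigD1 (i, i)) //= !inE eqxx leqnn expr1.
  rewrite big1 ?mulr1 // => -[p q] /= pq; rewrite !inE.
  case: eqP => // ep; case: eqP => // eq.
  by move: pq; rewrite ep eq eqxx.
rewrite /cdot (reindex_inj (inv_inj (symdiffK s))) /= -sumrN.
apply: eq_bigr => C _.
rewrite !generator_mulE symdiffK -/s blade_signDr ss; ring.
Qed.

Lemma cdot_paravectorl x a b :
  cdot (paravector x * a) b = cdot a (paravector_conj x * b).
Proof.
rewrite !mulrDl cdotDl cdotDr -!scalerAl !mul1r cdotZl cdotZr; congr (_ + _).
rewrite mulNr cdotNr !mulr_suml cdot_suml cdot_sumr -sumrN.
apply: eq_bigr => l _.
by rewrite -!scalerAl cdotZl cdotZr cdot_generatorl mulrN.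
Qed.

Definition sqn x : R := \sum_i x ord0 i ^+ 2.

Lemma vector_part_sqr x :
  (\sum_(l < n) x ord0 (lift ord0 l) *: generator R l) *
  (\sum_(l < n) x ord0 (lift ord0 l) *: generator R l) =
  (- \sum_(l < n) x ord0 (lift ord0 l) ^+ 2)%:A.
Proof.
set y := fun l => x ord0 (lift ord0 l).
pose e := generator R (n := n).
have E : (\sum_(l < n) y l *: e l) * (\sum_(l < n) y l *: e l) =
    \sum_l \sum_m (y l * y m) *: (e l * e m).
  rewrite mulr_suml; apply: eq_bigr => l _; rewrite mulr_sumr.
  by apply: eq_bigr => m _; rewrite -scalerAl -scalerAr scalerA.
rewrite -/y -/e E; set S := \sum_l _.
(* Adding the sum to its transpose pairs [e_l e_m] with [e_m e_l]: off-diagonal pairs cancel and the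
   diagonal gives twice the claim. *)
have two : S + S = (- \sum_l y l ^+ 2)%:A + (- \sum_l y l ^+ 2)%:A.
  rewrite {2}/S exchange_big /= -big_split /= -!scalerDl -opprD -big_split /=.
  rewrite -sumrN scaler_suml; apply: eq_bigr => l _.
  rewrite -big_split /= (bigD1 l) //= big1 ?addr0 => [|m ml].
    by rewrite generator_sqr scalerN -opprD -scalerDl -expr2 scaleNr.
  rewrite (mulrC (y m)) -scalerDr generator_anticomm ?scaler0 //.
  by rewrite eq_sym.
have two0 : (2 : R) != 0 by rewrite pnatr_eq0.
by apply: (scalerI two0); rewrite !scaler_nat.
Qed.

Lemma conj_paravectorM x : paravector_conj x * paravector x = (sqn x)%:A.
Proof.
rewrite /paravector /paravector_conj /sqn big_ord_recl; set u := \sum_(l < n) _.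
rewrite mulrBl !mulrDr vector_part_sqr -!scalerAl !mul1r -scalerAr mulr1 scalerA.
by rewrite opprD addrA addrK scaleNr opprK -scalerDl expr2.
Qed.

Lemma norm1 : `|1 : clifford R n| = 1.
Proof.
apply/eqP; rewrite -sqrp_eq1 ?normr_ge0 // sqr_norm_cdot /cdot.
rewrite (bigD1 finset.set0) //= big1 ?addr0 ?ffunE ?eqxx ?mul1r // => A A0.
by rewrite ffunE eq_sym (negbTE A0) mul0r.
Qed.

(** Left multiplication by x has left multiplication by xbar as its adjoint, and xbar x is the real
    number [sqn x]. A general left factor need not scale norms in this way. *)
Lemma sqr_norm_paravectorM x a :
  `|paravector x * a| ^+ 2 = sqn x * `|a| ^+ 2.
Proof.
rewrite !sqr_norm_cdot cdot_paravectorl mulrA conj_paravectorM.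
by rewrite -scalerAl mul1r cdotZr.
Qed.

Lemma sqr_norm_paravector x : `|paravector x| ^+ 2 = sqn x.
Proof. by rewrite -[paravector x]mulr1 sqr_norm_paravectorM norm1 expr1n mulr1. Qed.

Lemma norm_paravectorM x a : `|paravector x * a| = `|paravector x| * `|a|.
Proof.
apply/eqP; rewrite -(eqrXn2 (ltn0Sn 1)) ?mulr_ge0 //.
by rewrite sqr_norm_paravectorM exprMn sqr_norm_paravector.
Qed.

Lemma norm_paravectorX x k a :
  `|paravector x ^+ k * a| = `|paravector x| ^+ k * `|a|.
Proof.
elim: k => [|k ih]; first by rewrite !expr0 !mul1r.
by rewrite !exprS -mulrA norm_paravectorM ih mulrA.
Qed.

(** Writing xbar as the paravector of a reflected point transfers every fact about [paravector] to
    [paravector_conj]. *)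
Definition row_conj x : 'rV[R]_n.+1 :=
  \row_i (if i == ord0 then x ord0 i else - x ord0 i).

Lemma paravector_conjE x : paravector_conj x = paravector (row_conj x).
Proof.
rewrite /paravector /paravector_conj mxE eqxx; congr (_ + _).
by rewrite -sumrN; apply: eq_bigr => l _; rewrite mxE /= scaleNr.
Qed.

Lemma norm_row_conj x : `|paravector (row_conj x)| = `|paravector x|.
Proof.
apply/eqP; rewrite -(eqrXn2 (ltn0Sn 1)) // !sqr_norm_paravector.
apply/eqP; apply: eq_bigr => i _; rewrite mxE.
by case: eqP => // _; rewrite sqrrN.
Qed.

Lemma norm_coord_le a A : `|a A| <= `|a|.
Proof.
rewrite -(ler_pXn2r (ltn0Sn 1)) ?nnegrE // sqr_norm_cdot /cdot (bigD1 A) //=.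
rewrite -expr2 real_normK ?num_real // lerDl.
by apply: sumr_ge0 => B _; exact: sqr_ge0.
Qed.

Lemma norm_le_sum_coord a : `|a| <= \sum_A `|a A|.
Proof.
have aE : a = \sum_A a A *: blade R A.
  apply/ffunP => C; rewrite sum_ffunE (bigD1 C) //= big1 ?addr0.
    by rewrite !ffunE eqxx /GRing.scale /= mulr1.
  by move=> A neqAC; rewrite !ffunE (negbTE neqAC) scaler0.
rewrite {1}aE; apply: le_trans (ler_norm_sum _ _ _) _; apply: ler_sum => A _.
rewrite normrZ; have -> : `|blade R A| = 1; last by rewrite mulr1.
apply/eqP; rewrite -sqrp_eq1 ?normr_ge0 // sqr_norm_cdot /cdot.
rewrite (bigD1 A) //= big1 ?addr0 ?ffunE ?eqxx ?mul1r // => B BA.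
by rewrite !ffunE eq_sym (negbTE BA) mul0r.
Qed.

Lemma paravector_is_linear : linear (@paravector R n).
Proof.
move=> k x y; rewrite /paravector !mxE scalerDr scalerA scalerDl addrACA.
congr (_ + _); rewrite scaler_sumr -big_split /=.
by apply: eq_bigr => l _; rewrite !mxE scalerA scalerDl.
Qed.

HB.instance Definition _ := GRing.isLinear.Build R 'rV[R]_n.+1 (clifford R n)
  _ (@paravector R n) paravector_is_linear.

Lemma paravector_conj_is_linear : linear (@paravector_conj R n).
Proof.
move=> k x y; rewrite !paravector_conjE.
have -> : row_conj (k *: x + y) = k *: row_conj x + row_conj y.
  by apply/rowP => i; rewrite !mxE; case: ifP => _ //; rewrite opprD mulrN.
exact: linearP.
Qed.

HB.instance Definition _ := GRing.isLinear.Build R 'rV[R]_n.+1 (clifford R n)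
  _ (@paravector_conj R n) paravector_conj_is_linear.

Lemma norm_paravector_le x : `|paravector x| <= n.+1%:R * `|x|.
Proof.
rewrite -(ler_pXn2r (ltn0Sn 1)) ?nnegrE ?mulr_ge0 // sqr_norm_paravector /sqn.
apply: (@le_trans _ _ (\sum_(i < n.+1) `|x| ^+ 2)).
  apply: ler_sum => i _; rewrite -[x ord0 i ^+ 2]real_normK ?num_real //.
  rewrite ler_pXn2r ?nnegrE //.
  rewrite [X in _ <= X]/Num.norm /= mx_normrE.
  by apply/bigmax_geP; right; exists (ord0, i).
rewrite sumr_const card_ord exprMn -[leLHS]mulr_natl ler_wpM2r ?sqr_ge0 //.
by rewrite -natrX ler_nat -{1}[n.+1]expn1 leq_pexp2l.
Qed.

Lemma nbhs_norm_paravector_lt x (rho : R) : `|paravector x| < rho ->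
  nbhs x [set y | `|paravector y| < rho].
Proof.
move=> xrho.
have d0 : 0 < (rho - `|paravector x|) / n.+1%:R by rewrite divr_gt0 ?subr_gt0.
apply: filterS (nbhsx_ballx x _ d0) => y; rewrite -ball_normE /= => xy.
have -> : y = x + (y - x) by rewrite addrC subrK.
rewrite linearD; apply: le_lt_trans (ler_normD _ _) _; rewrite -ltrBrDl.
apply: le_lt_trans (norm_paravector_le _) _.
by rewrite mulrC -ltr_pdivlMr // distrC.
Qed.

End CliffordNorm.

Lemma cvg_sum_seq (R : realType) T (F : set_system T) {FF : Filter F} I
    (r : seq I) (f : I -> T -> R) (l : I -> R) :
  (forall i, f i @ F --> l i) ->
  (fun t => \sum_(i <- r) f i t) @ F --> \sum_(i <- r) l i.
Proof.
move=> fl; elim: r => [|i r ih].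
  by rewrite big_nil; under eq_fun do rewrite big_nil; exact: cvg_cst.
by rewrite big_cons; under eq_fun do rewrite big_cons; apply: cvgD ih.
Qed.

(** * Boundedness of the product and coordinatewise convergence *)

Section CliffordTopology.
Variables (R : realType) (n : nat).
Implicit Types (a b : clifford R n).

(** One factor counts the coordinates of a product, the other the terms in each coordinate. Only the
    existence of some finite constant matters. *)
Definition mul_const : R := #|{set 'I_n}|%:R * #|{set 'I_n}|%:R.

Lemma mul_const_ge0 : 0 <= mul_const.
Proof. by rewrite mulr_ge0. Qed.

Lemma norm_mul_le a b : `|a * b| <= mul_const * (`|a| * `|b|).
Proof.
apply: le_trans (norm_le_sum_coord _) _.
apply: (@le_trans _ _ (\sum_(C : {set 'I_n}) \sum_(A : {set 'I_n})
   (`|a| * `|b|))).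
  apply: ler_sum => C _; rewrite clifford_mulE.
  apply: le_trans (ler_norm_sum _ _ _) _; apply: ler_sum => A _.
  rewrite !normrM /blade_sign normrX normrN1 expr1n mul1r.
  by apply: ler_pM => //; exact: norm_coord_le.
by rewrite !sumr_const -mulrnA -[leLHS]mulr_natl natrM.
Qed.

Lemma cvg_clifford_coord T (F : set_system T) {FF : Filter F}
    (u : T -> clifford R n) (l : clifford R n) :
  (forall A, (fun t => u t A : R) @ F --> (l A : R)) -> u @ F --> l.
Proof.
move=> ul; apply/cvgrPdist_le => e e0.
have d0 : 0 < e / #|{set 'I_n}|%:R.
  by rewrite divr_gt0 // ltr0n; apply/card_gt0P; exists finset.set0.
have : \forall t \near F, forall A : {set 'I_n},
    `|l A - u t A| <= e / #|{set 'I_n}|%:R.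
  apply: filter_forall => A.
  by have /cvgrPdist_le := ul A; apply.
apply: filterS => t H; apply: le_trans (norm_le_sum_coord _) _.
apply: (@le_trans _ _ (\sum_(A : {set 'I_n}) e / #|{set 'I_n}|%:R)).
  by apply: ler_sum => A _; rewrite !ffunE; exact: H.
rewrite sumr_const -[leLHS]mulr_natr -mulrA mulVf ?mulr1 //.
by apply: contraTneq d0 => ->; rewrite invr0 mulr0 ltxx.
Qed.

Lemma cvg_clifford_mul T (F : set_system T) {FF : Filter F}
    (u w : T -> clifford R n) a b :
  u @ F --> a -> w @ F --> b -> (fun t => u t * w t) @ F --> a * b.
Proof.
have coord (v : T -> clifford R n) (l : clifford R n) A :
    v @ F --> l -> (fun t => v t A : R) @ F --> (l A : R).
  move=> /cvgrPdist_le vl; apply/cvgrPdist_le => e /vl; apply: filterS => t.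
  by apply: le_trans; have := norm_coord_le (l - v t) A; rewrite !ffunE.
move=> ua wb; apply: cvg_clifford_coord => C.
rewrite clifford_mulE; under eq_fun do rewrite clifford_mulE.
apply: cvg_sum_seq => A.
by apply: cvgM; [exact: cvg_cst|apply: cvgM; exact: coord].
Qed.

(** The norm dominates each coordinate, so absolute convergence of real series applies blade by
    blade. *)
Lemma cvg_series_clifford (u : nat -> clifford R n) (M : nat -> R) S :
  (forall k, `|u k| <= M k) -> (forall N, \sum_(k < N) M k <= S) ->
  cvgn (series u).
Proof.
move=> uM MS; apply/cvg_ex.
exists [ffun A => limn (series (fun k => u k A))].
apply: cvg_clifford_coord => A; rewrite ffunE.
have -> : (fun t => series u t A) = series (fun k => u k A).
  by apply/funext => N; rewrite /series /= sum_ffunE.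
apply: normed_cvg; apply: nondecreasing_is_cvgn.
  by apply: nondecreasing_series => i _ _; exact: normr_ge0.
exists S => _ [N _ <-]; apply: le_trans (MS N).
rewrite /normed_series_of /series /= big_mkord; apply: ler_sum => k _.
by apply: le_trans (uM k); exact: norm_coord_le.
Qed.

End CliffordTopology.

(** * Directional derivatives: product rule and remainder criterion *)

Section Derivative.
Variables (R : realType) (n : nat).
Notation V := 'rV[R]_n.+1.
Notation C := (clifford R n).
Implicit Types (f g : V -> C) (x v : V).

Lemma is_derive_clifford_mul f g x v df dg :
  is_derive x v f df -> is_derive x v g dg ->
  is_derive x v (fun y => f y * g y) (df * g x + f x * dg).
Proof.
move=> [fx <-] [gx <-].
suff H : (fun h => h^-1 *: (((fun y => f y * g y) \o shift x) (h *: v)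
    - f x * g x)) @ 0^' --> 'D_v f x * g x + f x * 'D_v g x.
  by split; [apply/cvg_ex; eexists; exact: H | exact: cvg_lim H].
(* Derivability along [v] gives continuity along that line only, which is all the product rule
   needs: the increment of [g] is [h] times its difference quotient. *)
have gc : (fun h => g (h *: v + x)) @ 0^' --> g x.
  have H : (fun h : R => h *: (h^-1 *: (g (h *: v + x) - g x)) + g x) @ 0^' -->
      0 *: 'D_v g x + g x.
    apply: cvgD; last exact: cvg_cst.
    apply: cvgZ; last exact: gx.
    exact: nbhs_dnbhs.
  rewrite scale0r add0r in H; apply: cvg_trans H; apply: near_eq_cvg.
  near=> h; rewrite scalerA divff ?scale1r ?subrK //.
  by near: h; exact: nbhs_dnbhs_neq.
have -> : (fun h => h^-1 *: (((fun y => f y * g y) \o shift x) (h *: v)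
    - f x * g x)) = (fun h =>
    (h^-1 *: (f (h *: v + x) - f x)) * g (h *: v + x)
    + f x * (h^-1 *: (g (h *: v + x) - g x))).
  apply/funext => h /=; rewrite -scalerAl -scalerAr -scalerDr mulrBl mulrBr.
  by rewrite addrA subrK.
apply: cvgD; first exact: (cvg_clifford_mul fx gc).
exact: (cvg_clifford_mul (cvg_cst (f x)) gx).
Unshelve. all: by end_near. Qed.

(** An explicit remainder bound passes to the limit of a series, unlike a bare limit of difference
    quotients; termwise differentiation is proved in this form. *)
Lemma is_derive_quadratic f x v df (K delta : R) : 0 < delta ->
  (forall t : R, `|t| < delta ->
     `|f (x + t *: v) - f x - t *: df| <= K * t ^+ 2) ->
  is_derive x v f df.
Proof.
move=> d0 H.
suff L : (fun h => h^-1 *: ((f \o shift x) (h *: v) - f x)) @ 0^' --> df.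
  by split; [apply/cvg_ex; eexists; exact: L | exact: cvg_lim L].
have K1 : 0 < `|K| + 1 by rewrite ltr_wpDl.
apply/cvgrPdist_le => e e0; near=> h.
have h0 : h != 0 by near: h; exact: nbhs_dnbhs_neq.
have hd : `|h| < delta.
  near: h; apply: dnbhs0_lt => //.
have he : `|h| < e / (`|K| + 1).
  by near: h; apply: dnbhs0_lt => //; rewrite divr_gt0.
rewrite distrC /= (addrC (h *: v)).
have -> : h^-1 *: (f (x + h *: v) - f x) - df =
    h^-1 *: (f (x + h *: v) - f x - h *: df).
  by rewrite [RHS]scalerBr scalerA mulVf ?scale1r.
rewrite normrZ normfV mulrC ler_pdivrMr ?normr_gt0 //.
apply: le_trans (H _ hd) _; rewrite -real_normK ?num_real // expr2 mulrA.
apply: ler_wpM2r => //.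
apply: (@le_trans _ _ ((`|K| + 1) * `|h|)).
  by apply: ler_wpM2r => //; rewrite (le_trans (ler_norm K)) // lerDl.
by rewrite mulrC -ler_pdivlMr // ltW.
Unshelve. all: by end_near. Qed.

End Derivative.

(** * Polynomial maps and their derivatives *)

Section PolynomialMaps.
Variables (R : realType) (n : nat).
Notation V := 'rV[R]_n.+1.
Notation A := (clifford R n).
Implicit Types (f g p q : V -> A) (x v : V).

(** Stable under ['D_v], so all iterated derivatives of a member exist. Linearity of ['D_v] in the
    direction [v] is also proved by induction on this predicate. *)
Inductive polymap : (V -> A) -> Prop :=
| polymap_cst a : polymap (fun=> a)
| polymap_paravector : polymap (@paravector R n)
| polymap_conj : polymap (@paravector_conj R n)
| polymap_add f g : polymap f -> polymap g -> polymap (fun x => f x + g x)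
| polymap_mul f g : polymap f -> polymap g -> polymap (fun x => f x * g x).

Lemma is_derive_linear (f : {linear V -> A}) x v : is_derive x v f (f v).
Proof.
apply: (@is_derive_quadratic _ _ _ _ _ _ 0 1) => // t _.
by rewrite linearD linearZ /= -addrA -opprD subrr normr0 mul0r.
Qed.

Lemma polymap_derivable f : polymap f -> forall v,
  (forall x, derivable f x v) /\ polymap ('D_v f).
Proof.
move=> pf v.
suff [f' pf' ff'] : exists2 f', polymap f' & forall x, is_derive x v f (f' x).
  split=> [x|]; first by have [] := ff' x.
  suff -> : 'D_v f = f' by [].
  by apply/funext => x; have [] := ff' x.
elim: pf => {f} [a|||f g pf [f' pf' ff'] pg [g' pg' gg']
  |f g pf [f' pf' ff'] pg [g' pg' gg']].
- by exists (fun=> 0); [exact: polymap_cst | move=> x; exact: is_derive_cst].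
- exists (fun=> paravector v); [exact: polymap_cst | move=> x].
  exact: is_derive_linear.
- exists (fun=> paravector_conj v); [exact: polymap_cst | move=> x].
  exact: is_derive_linear.
- exists (fun x => f' x + g' x); first exact: polymap_add.
  by move=> x; apply: is_deriveD.
- exists (fun x => f' x * g x + f x * g' x).
    by apply: polymap_add; exact: polymap_mul.
  by move=> x; apply: is_derive_clifford_mul.
Qed.

Lemma polymap_is_derive f x v : polymap f -> is_derive x v f ('D_v f x).
Proof. by move=> /polymap_derivable/(_ v)[fx _]; apply/derivableP. Qed.

Lemma polymap_derive f v : polymap f -> polymap ('D_v f).
Proof. by move=> /polymap_derivable/(_ v)[]. Qed.

Lemma deriv_cst (a : A) v : 'D_v (fun _ : V => a) = fun=> 0.
Proof. by apply/funext => x; exact: derive_cst. Qed.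

Lemma derive_paravector x v : 'D_v (@paravector R n) x = paravector v.
Proof. by have [] := is_derive_linear (@paravector R n) x v. Qed.

Lemma derive_conj x v : 'D_v (@paravector_conj R n) x = paravector_conj v.
Proof. by have [] := is_derive_linear (@paravector_conj R n) x v. Qed.

Lemma deriv_add f g v : polymap f -> polymap g ->
  'D_v (fun x => f x + g x) = fun x => 'D_v f x + 'D_v g x.
Proof.
move=> pf pg; apply/funext => x.
by have [] := is_deriveD (polymap_is_derive x v pf) (polymap_is_derive x v pg).
Qed.

Lemma deriv_mul f g v : polymap f -> polymap g ->
  'D_v (fun x => f x * g x) = fun x => 'D_v f x * g x + f x * 'D_v g x.
Proof.
move=> pf pg; apply/funext => x.
by have [] := is_derive_clifford_mul (polymap_is_derive x v pf)
  (polymap_is_derive x v pg).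
Qed.

Lemma polymap_scale (k : R) f : polymap f -> polymap (fun x => k *: f x).
Proof.
move=> pf; have -> : (fun x => k *: f x) = (fun x => k%:A * f x).
  by apply/funext => x; rewrite -scalerAl mul1r.
by apply: polymap_mul => //; exact: polymap_cst.
Qed.

Lemma deriv_scale (k : R) f v : polymap f ->
  'D_v (fun x => k *: f x) = fun x => k *: 'D_v f x.
Proof.
move=> pf; apply/funext => x.
by have [] := is_deriveZ k (polymap_is_derive x v pf).
Qed.

Lemma polymap_sum I (r : seq I) (F : I -> V -> A) :
  (forall i, polymap (F i)) -> polymap (fun x => \sum_(i <- r) F i x).
Proof.
move=> pF; elim: r => [|i r ih].
  by under eq_fun do rewrite big_nil; exact: polymap_cst.
by under eq_fun do rewrite big_cons; apply: polymap_add.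
Qed.

Lemma deriv_sum I (r : seq I) (F : I -> V -> A) v :
  (forall i, polymap (F i)) ->
  'D_v (fun x => \sum_(i <- r) F i x) = fun x => \sum_(i <- r) 'D_v (F i) x.
Proof.
move=> pF; elim: r => [|i r ih].
  have -> : (fun x => \sum_(i <- [::]) F i x) = fun=> 0.
    by apply/funext => x; rewrite big_nil.
  by rewrite deriv_cst; apply/funext => x; rewrite big_nil.
have -> : (fun x => \sum_(j <- i :: r) F j x) =
    fun x => F i x + \sum_(j <- r) F j x.
  by apply/funext => x; rewrite big_cons.
rewrite deriv_add //; last exact: polymap_sum.
apply/funext => x; rewrite big_cons; congr (_ + _).
exact: (congr1 (fun h => h x) ih).
Qed.

Lemma derive_polyD f g v x : polymap f -> polymap g ->
  'D_v (fun x => f x + g x) x = 'D_v f x + 'D_v g x.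
Proof.
by move=> pf pg; exact: (congr1 (fun h => h x) (deriv_add v pf pg)).
Qed.

Lemma derive_polyM f g v x : polymap f -> polymap g ->
  'D_v (fun x => f x * g x) x = 'D_v f x * g x + f x * 'D_v g x.
Proof.
by move=> pf pg; exact: (congr1 (fun h => h x) (deriv_mul v pf pg)).
Qed.

Lemma derive_polyZ (k : R) f v x : polymap f ->
  'D_v (fun x => k *: f x) x = k *: 'D_v f x.
Proof.
by move=> pf; exact: (congr1 (fun h => h x) (deriv_scale k v pf)).
Qed.

Lemma derive_poly_sum I (r : seq I) (F : I -> V -> A) v x :
  (forall i, polymap (F i)) ->
  'D_v (fun x => \sum_(i <- r) F i x) x = \sum_(i <- r) 'D_v (F i) x.
Proof.
by move=> pF; exact: (congr1 (fun h => h x) (deriv_sum r v pF)).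
Qed.

Lemma polymap_exp f k : polymap f -> polymap (fun x => f x ^+ k).
Proof.
move=> pf; elim: k => [|k ih].
  by under eq_fun do rewrite expr0; exact: polymap_cst.
by under eq_fun do rewrite exprS; exact: polymap_mul.
Qed.

Notation N := (fun x : V => `|paravector x|).

(* Bounds of order up to [m] for a map which behaves like [C |x|^k]; left
   multiplication by the variable raises [k] by one and keeps [C], so that
   [x^k] satisfies them with [C = 1]. *)
Fixpoint tame (m k : nat) (C : R) p : Prop :=
  (forall x, `|p x| <= C * N x ^+ k) /\
  if m is m'.+1 then
    [/\ forall x v, `|p (x + v) - p x| <= k%:R * C * N v * (N x + N v) ^+ k.-1,
        forall x v, `|p (x + v) - p x - 'D_v p x| <=
          (k * k.-1)%:R * C * N v ^+ 2 * (N x + N v) ^+ k.-2 &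
        forall v, tame m' k.-1 (k%:R * C * N v) ('D_v p)]
  else True.

Lemma tame_le m k C p : tame m k C p -> forall x, `|p x| <= C * N x ^+ k.
Proof. by case: m => [|m] []. Qed.

Lemma tameW m k C p : tame m.+1 k C p -> tame m k C p.
Proof.
elim: m k C p => [|m ih] k C p; first by case.
by move=> [p0 [p1 p2 p3]]; split=> //; split=> // v; apply/ih/p3.
Qed.

Lemma tame0 m k : tame m k 0 (fun=> 0).
Proof.
elim: m k => [|m ih] k; split => //; do ?[by move=> x; rewrite normr0 mul0r].
split=> [x v|x v|v].
- by rewrite subrr normr0 mulr0 !mul0r.
- by rewrite derive_cst !subrr normr0 mulr0 !mul0r.
- by rewrite mulr0 mul0r deriv_cst; exact: ih.
Qed.

Lemma tame_zero m k p : tame m k 0 p -> p = fun=> 0.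
Proof.
move=> /tame_le p0; apply/funext => x; apply/eqP; rewrite -normr_le0.
by apply: le_trans (p0 x) _; rewrite mul0r.
Qed.

Lemma tame_cst m (a : A) : tame m 0 `|a| (fun=> a).
Proof.
case: m => [|m]; split=> //; do ?[by move=> x; rewrite expr0 mulr1].
split=> [x v|x v|v].
- by rewrite subrr normr0 !mul0r.
- by rewrite derive_cst !subrr normr0 !mul0r.
- by rewrite !mul0r deriv_cst; exact: tame0.
Qed.

Lemma tame_add m k C D p q : polymap p -> polymap q ->
  tame m k C p -> tame m k D q -> tame m k (C + D) (fun x => p x + q x).
Proof.
elim: m k C D p q => [|m ih] k C D p q pp pq [p0 Hp] [q0 Hq].
  split=> // x; apply: le_trans (ler_normD _ _) _; rewrite mulrDl.
  exact: lerD.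
case: Hp Hq => p1 p2 p3 [q1 q2 q3]; split.
  move=> x; apply: le_trans (ler_normD _ _) _; rewrite mulrDl.
  exact: lerD.
split=> [x v|x v|v].
- rewrite opprD addrACA; apply: le_trans (ler_normD _ _) _.
  by rewrite mulrDr !mulrDl; exact: lerD.
- have -> : 'D_v (fun x => p x + q x) x = 'D_v p x + 'D_v q x.
    exact: derive_polyD.
  rewrite !opprD (addrACA (p _)) (addrACA (p _ - p _)).
  apply: le_trans (ler_normD _ _) _.
  by rewrite mulrDr !mulrDl; exact: lerD.
- rewrite deriv_add // mulrDr mulrDl.
  exact: (ih _ _ _ _ _ (polymap_derive v pp) (polymap_derive v pq)
    (p3 v) (q3 v)).
Qed.

(** Common source of two cases: multiplication by a constant on the right, which costs [mul_const],
    and by a paravector on the left, which scales norms exactly. *)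
Lemma tame_linear m k C (c : R) (L : A -> A) p :
  {morph L : a b / a - b} -> (forall a, `|L a| <= c * `|a|) -> 0 <= c ->
  (forall q v, polymap q -> 'D_v (L \o q) = L \o 'D_v q) ->
  polymap p -> tame m k C p -> tame m k (c * C) (L \o p).
Proof.
move=> LB Lc c0 DL; elim: m k C p => [|m ih] k C p pp [p0 Hp].
  split=> // x; apply: le_trans (Lc _) _; rewrite -mulrA.
  exact: ler_wpM2l.
case: Hp => p1 p2 p3; split.
  by move=> x; apply: le_trans (Lc _) _; rewrite -mulrA; exact: ler_wpM2l.
split=> [x v|x v|v].
- rewrite /= -LB; apply: le_trans (Lc _) _.
  by rewrite (mulrCA _ c) -!(mulrA c); exact: ler_wpM2l.
- have -> : 'D_v (L \o p) x = L ('D_v p x).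
    exact: (congr1 (fun h => h x) (DL _ v pp)).
  rewrite /= -!LB; apply: le_trans (Lc _) _.
  by rewrite (mulrCA _ c) -!(mulrA c); exact: ler_wpM2l.
- rewrite DL // (mulrCA _ c) -!(mulrA c).
  exact: (ih _ _ _ (polymap_derive v pp) (p3 v)).
Qed.

Lemma tame_mulr m k C p (b : A) : polymap p -> tame m k C p ->
  tame m k (mul_const R n * `|b| * C) (fun x => p x * b).
Proof.
move=> pp; apply: (@tame_linear _ _ _ _ (fun a => a * b)) => //.
- by move=> a a'; rewrite mulrBl.
- by move=> a; rewrite -mulrA (mulrC `|b|); exact: norm_mul_le.
- by rewrite mulr_ge0 // mul_const_ge0.
- move=> q v pq; rewrite [LHS](deriv_mul v pq (polymap_cst b)).
  apply/funext => x; rewrite derive_cst mulr0 addr0; reflexivity.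
Qed.

Lemma tame_paravector_mull m k C v p : polymap p -> tame m k C p ->
  tame m k (N v * C) (fun x => paravector v * p x).
Proof.
move=> pp; apply: (@tame_linear _ _ _ _ ( *%R (paravector v))) => //.
- by move=> a a'; rewrite mulrBr.
- by move=> a; rewrite /= norm_paravectorM.
- move=> q w pq; rewrite [LHS](deriv_mul w (polymap_cst _) pq).
  apply/funext => x; rewrite derive_cst mul0r add0r; reflexivity.
Qed.

Lemma derive_paravectorM p v x : polymap p -> 'D_v (fun x => paravector x * p x) x =
  paravector v * p x + paravector x * 'D_v p x.
Proof.
move=> pp; apply: etrans (derive_polyM v x polymap_paravector pp) _.
by rewrite derive_paravector.
Qed.

Lemma tame_paravectorM m k C p : 0 <= C -> polymap p -> tame m k C p ->
  tame m k.+1 C (fun x => paravector x * p x).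
Proof.
elim: m k C p => [|m ih] k C p C0 pp [p0 Hp].
  split=> // x; rewrite norm_paravectorM exprS mulrCA.
  exact: ler_wpM2l.
have NN x v : N x <= N x + N v by rewrite lerDl.
have N0 x v : 0 <= N x + N v by rewrite addr_ge0.
have mulBE (X W P Q : A) : (X + W) * P - X * Q = (X + W) * (P - Q) + W * Q.
  by rewrite mulrBr (mulrDl _ _ Q) opprD addrA subrK.
have mulBBE (X W P Q D : A) : (X + W) * P - X * Q - (W * Q + X * D) =
    X * (P - Q - D) + W * (P - Q).
  by rewrite mulBE mulrDl [in RHS]mulrBr opprD addrA addrK addrAC.
have splitp x v : paravector (x + v) * p (x + v) - paravector x * p x =
    paravector (x + v) * (p (x + v) - p x) + paravector v * p x.
  by rewrite linearD; exact: mulBE.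
case: Hp => p1 p2 p3; split.
  move=> x; rewrite norm_paravectorM exprS mulrCA.
  exact: ler_wpM2l.
split=> [x v|x v|v].
- rewrite splitp; apply: le_trans (ler_normD _ _) _; rewrite !norm_paravectorM.
  have h1 : N (x + v) * `|p (x + v) - p x| <=
      (N x + N v) * (k%:R * C * N v * (N x + N v) ^+ k.-1).
    by apply: ler_pM => //; rewrite linearD; exact: ler_normD.
  have h2 : N v * `|p x| <= N v * (C * (N x + N v) ^+ k).
    apply: ler_wpM2l => //; apply: le_trans (p0 x) _; apply: ler_wpM2l => //.
    by apply: lerXn2r; rewrite ?nnegrE.
  apply: le_trans (lerD h1 h2) _; rewrite le_eqVlt; apply/orP; left; apply/eqP.
  case: k {p0 p1 p2 p3 h1 h2} => [|k] /=; first by rewrite expr0; ring.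
  by rewrite exprS -!natr1; ring.
- rewrite derive_paravectorM //.
  have -> : paravector (x + v) * p (x + v) - paravector x * p x -
      (paravector v * p x + paravector x * 'D_v p x) =
      paravector x * (p (x + v) - p x - 'D_v p x)
      + paravector v * (p (x + v) - p x).
    by rewrite linearD; exact: mulBBE.
  apply: le_trans (ler_normD _ _) _; rewrite !norm_paravectorM.
  have h1 : N x * `|p (x + v) - p x - 'D_v p x| <= (N x + N v) *
      ((k * k.-1)%:R * C * N v ^+ 2 * (N x + N v) ^+ k.-2).
    exact: ler_pM.
  have h2 : N v * `|p (x + v) - p x| <=
      N v * (k%:R * C * N v * (N x + N v) ^+ k.-1).
    exact: ler_wpM2l.
  apply: le_trans (lerD h1 h2) _.
  case: k {p0 p1 p2 p3 h1 h2} => [|[|k]] /=.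
  - by rewrite !(muln0, mulr0n, mul0r, mulr0, addr0).
  - rewrite muln0 mulr0n muln1 !(mul0r, mulr0) add0r expr0 !(mul1r, mulr1).
    rewrite -subr_ge0.
    have -> : 2 * C * N v ^+ 2 - N v * (C * N v) = C * N v ^+ 2 by ring.
    by rewrite mulr_ge0 // sqr_ge0.
  - rewrite exprS -subr_ge0 !natrM -!natr1.
    set X := _ - _.
    have -> : X = (k%:R + 1 + 1) * C * N v ^+ 2
        * ((N x + N v) * (N x + N v) ^+ k) by rewrite /X !exprS; ring.
    by rewrite !mulr_ge0 // ?sqr_ge0 ?exprn_ge0 ?addr_ge0 // ?ler01.
- have -> : 'D_v (fun x => paravector x * p x) =
      fun x => paravector v * p x + paravector x * 'D_v p x.
    by apply/funext => x; exact: derive_paravectorM.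
  have -> : k.+1%:R * C * N v = N v * C + k%:R * C * N v.
    by rewrite -natr1; ring.
  have pD := polymap_derive v pp.
  apply: tame_add.
  - exact: polymap_mul (polymap_cst _) pp.
  - exact: polymap_mul polymap_paravector pD.
  - by apply: tame_paravector_mull => //; apply: tameW; split.
  (* The induction hypothesis yields the exponent [k.-1.+1], which is wrong for [k = 0]. In that
     case the bound on ['D_v p] carries the factor 0, so the term vanishes identically. *)
  - case: k {p0 p1 p2} p3 => [|k] p3 /=.
      have := p3 v; rewrite !mul0r => /tame_zero D0.
      have -> : (fun x => paravector x * 'D_v p x) = fun=> 0.
        apply/funext => x; have /= -> := congr1 (fun h => h x) D0.
        exact: mulr0.
      exact: tame0.
    by apply: (ih _ _ _ _ pD (p3 v)); rewrite !mulr_ge0.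
Qed.

End PolynomialMaps.

(** * Termwise differentiation *)

Section TermwiseDerivative.
Variables (R : realType) (n : nat).
Notation V := 'rV[R]_n.+1.
Notation A := (clifford R n).
Notation N := (fun x : V => `|paravector x|).
Implicit Types (f g F : V -> A) (x v : V) (p : nat -> V -> A).

(** One term of the binomial expansion: the factor [e] produced by a derivative is traded for an
    increase [d] of the radius. *)
Lemma expr_ge_first (r d : R) e : 0 <= r -> 0 <= d ->
  e%:R * r ^+ e.-1 * d <= (r + d) ^+ e.
Proof.
move=> r0 d0; elim: e => [|e ih]; first by rewrite !mul0r expr0 ler01.
have rd : r ^+ e <= (r + d) ^+ e by rewrite lerXn2r ?nnegrE ?addr_ge0 // lerDl.
rewrite exprS mulrDl /=; apply: le_trans (lerD (ler_wpM2l r0 ih) (ler_wpM2l d0 rd)).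
rewrite le_eqVlt; apply/orP; left; apply/eqP.
case: e {ih rd} => [|e] /=; first by rewrite expr0; ring.
by rewrite -!natr1 exprS; ring.
Qed.

(** The same trade for a second-order remainder; the 2 is the denominator of the binomial
    coefficient. *)
Lemma expr_ge_second (r d : R) e : 0 <= r -> 0 <= d ->
  (e * e.-1)%:R * r ^+ e.-2 * d ^+ 2 <= 2 * (r + d) ^+ e.
Proof.
move=> r0 d0; elim: e => [|e ih].
  by rewrite !mul0r expr0 mulr1.
have := lerD (ler_wpM2l r0 ih)
  (ler_wpM2l (mulr_ge0 (ler0n R 2) d0) (expr_ge_first e r0 d0)).
move=> H; rewrite [leRHS](_ : _ =
  r * (2 * (r + d) ^+ e) + 2 * d * (r + d) ^+ e); last by rewrite exprS; ring.
apply: le_trans H; rewrite le_eqVlt; apply/orP; left; apply/eqP.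
case: e {ih} => [|[|e]] /=.
- by rewrite muln0 expr0; ring.
- by rewrite muln0 expr0; ring.
- by rewrite !natrM -!natr1 !exprS; ring.
Qed.

Lemma polymap_deriveZ (t : R) x v f : polymap f ->
  'D_(t *: v) f x = t *: 'D_v f x.
Proof.
elim=> {f} [a|||f g pf ihf pg ihg|f g pf ihf pg ihg].
- by rewrite !derive_cst scaler0.
- by rewrite !derive_paravector linearZ.
- by rewrite !derive_conj linearZ.
- have D w : 'D_w (fun x => f x + g x) x = 'D_w f x + 'D_w g x.
    exact: derive_polyD.
  by rewrite !D ihf ihg scalerDr.
- have D w : 'D_w (fun x => f x * g x) x = 'D_w f x * g x + f x * 'D_w g x.
    exact: derive_polyM.
  by rewrite !D ihf ihg scalerDr scalerAl scalerAr.
Qed.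

Lemma norm_lim_le (u : nat -> A) (l : A) (B : R) :
  u @ \oo --> l -> (forall k, `|u k| <= B) -> `|l| <= B.
Proof.
move=> ul uB; apply/ler_addgt0Pl => e e0.
have /cvgrPdist_le/(_ _ e0)[M _ /(_ M (leqnn M))] := ul => /= h.
rewrite -[l](subrK (u M)); apply: le_trans (ler_normD _ _) _.
exact: lerD.
Qed.

Variable P : R -> Prop.

(** A union of balls over admissible radii, not one ball, so that an infinite radius needs no
    separate case. *)
Definition radial : set V := [set x | exists2 rho, P rho & N x < rho].

(** The degree is a function [e] of the index because a derivative lowers degrees without
    renumbering the series. Asking for [tame] at every order [m] makes the notion stable under
    derivatives. *)
Definition dominated (e : nat -> nat) (C : nat -> R) p :=
  [/\ forall k, polymap (p k), forall k, 0 <= C k,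
      forall m k, tame m (e k) (C k) (p k) &
      forall rho r, P rho -> 0 <= r < rho ->
        exists S, forall M, \sum_(k < M) C k * r ^+ e k <= S].

Lemma dominated_cvg e C p x : dominated e C p -> radial x ->
  cvgn (series (fun k => p k x)).
Proof.
move=> [_ _ pT pS] [rho Prho xrho].
have [|S HS] := pS rho (N x) Prho; first by rewrite normr_ge0.
apply: (@cvg_series_clifford _ _ _ (fun k => C k * N x ^+ e k) S) => // k.
exact: tame_le (pT 0%N k) x.
Qed.

Lemma dominated_derive e C p v : dominated e C p ->
  dominated (fun k => (e k).-1) (fun k => (e k)%:R * C k * N v)
    (fun k => 'D_v (p k)).
Proof.
move=> [pp pC pT pS]; split=> [k|k|m k|rho r Prho /andP[r0 rrho]].
- exact: polymap_derive.
- by rewrite !mulr_ge0.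
- by have [_ [_ _]] := pT m.+1 k; apply.
(* The intermediate radius [s] absorbs the factor [e k] of the derivative, at the price of the
   constant [N v / (s - r)]. *)
have [s /andP[rs srho]] : exists s, r < s < rho.
  by exists ((r + rho) / 2); rewrite midf_lt //= midf_lt.
have s0 : 0 <= s by rewrite (le_trans r0) // ltW.
have [|S HS] := pS rho s Prho; first by rewrite s0.
have d0 : 0 < s - r by rewrite subr_gt0.
exists ((N v / (s - r)) * S) => M.
apply: le_trans (_ : \sum_(k < M) (N v / (s - r)) * (C k * s ^+ e k) <= _).
  apply: ler_sum => k _.
  have h : (e k)%:R * r ^+ (e k).-1 <= s ^+ e k / (s - r).
    rewrite ler_pdivlMr //; have := expr_ge_first (e k) r0 (ltW d0).
    by rewrite [r + _]addrC subrK.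
  have h' := ler_wpM2l (mulr_ge0 (pC k) (normr_ge0 (paravector v))) h.
  rewrite [leLHS](_ : _ = C k * N v * ((e k)%:R * r ^+ (e k).-1)); last by ring.
  by rewrite [leRHS](_ : _ = C k * N v * (s ^+ e k / (s - r))); last by ring.
rewrite -mulr_sumr; apply: ler_wpM2l; last exact: HS.
by rewrite divr_ge0 // ltW.
Qed.

Lemma dominated_sum (I : finType) e (C : I -> nat -> R)
    (p : I -> nat -> V -> A) :
  (forall i, dominated e (C i) (p i)) ->
  dominated e (fun k => \sum_i C i k) (fun k x => \sum_i p i k x).
Proof.
move=> H; split=> [k|k|m k|rho r Prho rrho].
- by apply: polymap_sum => i; have [] := H i.
- by apply: sumr_ge0 => i _; have [] := H i.
- elim: (index_enum I) => [|i s ih].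
    rewrite big_nil; have -> : (fun x => \sum_(i <- [::]) p i k x) = fun=> 0.
      by apply/funext => x; rewrite big_nil.
    exact: tame0.
  rewrite big_cons; have -> : (fun x => \sum_(j <- i :: s) p j k x) =
      fun x => p i k x + \sum_(j <- s) p j k x.
    by apply/funext => x; rewrite big_cons.
  have [pi _ ti _] := H i; apply: tame_add => //.
  by apply: polymap_sum => j; have [] := H j.
- have : forall i, exists S, forall M, \sum_(k < M) C i k * r ^+ e k <= S.
    by move=> i; have [_ _ _ /(_ rho r Prho rrho)] := H i.
  move=> /choice[S HS]; exists (\sum_i S i) => M.
  under eq_bigr do rewrite mulr_suml.
  by rewrite exchange_big /=; apply: ler_sum => i _; exact: HS.
Qed.

Lemma is_derive_series e C p F G x v : dominated e C p ->
  (forall y, radial y -> series (fun k => p k y) @ \oo --> F y) ->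
  radial x -> series (fun k => 'D_v (p k) x) @ \oo --> G ->
  is_derive x v F G.
Proof.
move=> [pp pC pT pS] pF xU pG; have [rho Prho xrho] := xU.
(* Two intermediate radii: [r] leaves room for the points [x + t *: v], and [s] absorbs the factor
   [e k * (e k).-1] of the second-order bound. *)
have [r /andP[xr rrho]] : exists r, N x < r < rho.
  by exists ((N x + rho) / 2); rewrite midf_lt //= midf_lt.
have [s /andP[rs srho]] : exists s, r < s < rho.
  by exists ((r + rho) / 2); rewrite midf_lt //= midf_lt.
have r0 : 0 <= r by rewrite (le_trans _ (ltW xr)).
have s0 : 0 <= s by rewrite (le_trans r0) // ltW.
have d0 : 0 < s - r by rewrite subr_gt0.
have [|S HS] := pS rho s Prho; first by rewrite s0.
have v1 : 0 < N v + 1 by rewrite ltr_wpDl.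
(* The [+ 1] covers the case [N v = 0]. *)
have del0 : 0 < (r - N x) / (N v + 1) by rewrite divr_gt0 // subr_gt0.
apply: (is_derive_quadratic (K := N v ^+ 2 * (2 / (s - r) ^+ 2) * S) del0).
move=> t; rewrite ltr_pdivlMr // => tdel.
have tx : N x + N (t *: v) <= r.
  rewrite linearZ /= normrZ -lerBrDl; apply: le_trans (ltW tdel).
  by rewrite ler_wpM2l // lerDl.
have xtv : radial (x + t *: v).
  exists rho => //; apply: le_lt_trans rrho; apply: le_trans tx.
  by rewrite linearD; exact: ler_normD.
pose u k := p k (x + t *: v) - p k x - t *: 'D_v (p k) x.
have Eu M : \sum_(k < M) u k = series (fun k => p k (x + t *: v)) M
    - series (fun k => p k x) M - t *: series (fun k => 'D_v (p k) x) M.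
  by rewrite /series /= !big_mkord scaler_sumr -!sumrB.
have uF : (fun M => \sum_(k < M) u k) @ \oo -->
    F (x + t *: v) - F x - t *: G.
  rewrite (funext Eu); apply: cvgB; last exact: (cvgZ (cvg_cst t) pG).
  by apply: cvgB; exact: pF.
apply: (norm_lim_le uF) => M; apply: le_trans (ler_norm_sum _ _ _) _.
apply: (@le_trans _ _ (\sum_(k < M)
    (N v ^+ 2 * (2 / (s - r) ^+ 2) * t ^+ 2) * (C k * s ^+ e k))).
  apply: ler_sum => k _; rewrite /u -polymap_deriveZ //.
  have [_ [_ /(_ x (t *: v)) + _]] := pT 1%N k.
  move=> /le_trans; apply; rewrite linearZ /= normrZ.
  have h : (e k * (e k).-1)%:R * (N x + N (t *: v)) ^+ (e k).-2 <=
      2 / (s - r) ^+ 2 * s ^+ e k.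
    apply: (@le_trans _ _ ((e k * (e k).-1)%:R * r ^+ (e k).-2)).
      by apply: ler_wpM2l => //; apply: lerXn2r; rewrite ?nnegrE ?addr_ge0.
    rewrite mulrAC ler_pdivlMr ?exprn_gt0 //.
    have := expr_ge_second (e k) r0 (ltW d0).
    by rewrite [r + _]addrC subrK.
  rewrite linearZ /= normrZ in h.
  have tv0 : 0 <= C k * (`|t| * N v) ^+ 2 by rewrite mulr_ge0 // exprn_ge0 // mulr_ge0.
  have := ler_wpM2l tv0 h; set w := (e k * _)%:R; set z := _ ^+ (e k).-2.
  have -> : t ^+ 2 = `|t| ^+ 2 by rewrite real_normK ?num_real.
  move=> H; rewrite [leLHS](_ : _ = C k * (`|t| * N v) ^+ 2 * (w * z)); last by ring.
  by apply: le_trans H _; rewrite le_eqVlt; apply/orP; left; apply/eqP; ring.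
rewrite -mulr_sumr [leRHS]mulrAC.
apply: ler_wpM2l; last exact: HS.
by rewrite mulr_ge0 ?sqr_ge0 // mulr_ge0 ?sqr_ge0 // divr_ge0 ?sqr_ge0.
Qed.

Lemma derive_series e C p F x v : dominated e C p ->
  (forall y, radial y -> series (fun k => p k y) @ \oo --> F y) ->
  radial x -> derivable F x v /\
    series (fun k => 'D_v (p k) x) @ \oo --> 'D_v F x.
Proof.
move=> pd pF xU; have /cvg_ex[/= G pG] := dominated_cvg (dominated_derive v pd) xU.
by have [FD ->] := is_derive_series pd pF xU pG; split.
Qed.

End TermwiseDerivative.

(** * Termwise application of the iterated Laplacian *)

Section LaplacianSeries.
Variables (R : realType) (n : nat) (P : R -> Prop).
Notation V := 'rV[R]_n.+1.
Notation A := (clifford R n).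
Implicit Types (f g F : V -> A) (x v : V) (p : nat -> V -> A).

Lemma polymap_laplacian f : polymap f -> polymap (laplacian f).
Proof.
by move=> pf; apply: polymap_sum => i; do 2 apply: polymap_derive.
Qed.

Lemma polymap_iter_laplacian j f : polymap f -> polymap (iter j (@laplacian R n) f).
Proof. by move=> pf; elim: j => //= j; exact: polymap_laplacian. Qed.

Definition sums_to p F := forall x, radial P x ->
  series (fun k => p k x) @ \oo --> F x.

(** Domination is part of the conclusion so that the result can be iterated; the new degrees and
    constants no longer matter and are hidden by existentials. *)
Lemma laplacian_series e C p F : dominated P e C p -> sums_to p F ->
  [/\ exists e' C', dominated P e' C' (fun k => laplacian (p k)),
      sums_to (fun k => laplacian (p k)) (laplacian F) &
      forall x v, radial P x ->
        derivable F x v /\ derivable ('D_v F) x v].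
Proof.
move=> pd pF.
have D1 v x : radial P x -> derivable F x v /\
    (series (fun k => 'D_v (p k) x) @ \oo --> 'D_v F x).
  exact: derive_series pd pF.
have D2 v x : radial P x -> derivable ('D_v F) x v /\
    (series (fun k => 'D_v ('D_v (p k)) x) @ \oo --> 'D_v ('D_v F) x).
  apply: derive_series (dominated_derive v pd) _ => y yU.
  exact: (D1 v y yU).2.
split=> [|x xU|x v xU].
- exists (fun k => (e k).-1.-1); eexists.
  pose w (i : 'I_n.+1) : V := delta_mx ord0 i.
  exact: (dominated_sum (fun i => dominated_derive (w i) (dominated_derive (w i) pd))).
- have -> : series (fun k => laplacian (p k) x) = fun M => \sum_(i < n.+1)
      series (fun k => 'D_(delta_mx ord0 i) ('D_(delta_mx ord0 i) (p k)) x) M.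
    by apply/funext => M; rewrite /series /= exchange_big.
  rewrite /laplacian; elim: (index_enum _) => [|i s ih].
    by rewrite big_nil; under eq_fun do rewrite big_nil; exact: cvg_cst.
  rewrite big_cons; under eq_fun do rewrite big_cons.
  by apply: cvgD ih; have [] := D2 (delta_mx ord0 i) x xU.
- by split; [have [] := D1 v x xU | have [] := D2 v x xU].
Qed.

Lemma iter_laplacian_series j e C p F : dominated P e C p -> sums_to p F ->
  (exists e' C', dominated P e' C' (fun k => iter j (@laplacian R n) (p k))) /\
  sums_to (fun k => iter j (@laplacian R n) (p k)) (iter j (@laplacian R n) F).
Proof.
move=> pd pF; elim: j => [|j [[e' [C' pd']] ih]].
  by split=> //; exists e, C.
by have [] := laplacian_series pd' ih.
Qed.

End LaplacianSeries.

(** * Leibniz rule for the Laplacian on polynomial maps *)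

Section LaplacianAlgebra.
Variables (R : realType) (n : nat).
Notation V := 'rV[R]_n.+1.
Notation A := (clifford R n).
Implicit Types (f g : V -> A) (x v : V).
Notation par := (@paravector R n).
Notation conj := (@paravector_conj R n).

Lemma polymap_deriveDv v w x f : polymap f ->
  'D_(v + w) f x = 'D_v f x + 'D_w f x.
Proof.
elim=> {f} [a|||f g pf ihf pg ihg|f g pf ihf pg ihg].
- by rewrite !derive_cst addr0.
- by rewrite !derive_paravector linearD.
- by rewrite !derive_conj linearD.
- have D u : 'D_u (fun x => f x + g x) x = 'D_u f x + 'D_u g x.
    exact: derive_polyD.
  rewrite D; apply: etrans (f_equal2 +%R ihf ihg) _; rewrite addrACA.
  exact: esym (f_equal2 +%R (D v) (D w)).
- have D u : 'D_u (fun x => f x * g x) x = 'D_u f x * g x + f x * 'D_u g x.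
    exact: derive_polyM.
  rewrite D.
  apply: etrans (f_equal2 (fun a b => a * g x + f x * b) ihf ihg) _.
  rewrite mulrDl mulrDr addrACA.
  exact: esym (f_equal2 +%R (D v) (D w)).
Qed.

Lemma derive_coord v x f : polymap f ->
  'D_v f x = \sum_i v ord0 i *: 'D_(delta_mx ord0 i) f x.
Proof.
move=> pf; rewrite {1}(row_sum_delta v).
elim: (index_enum _) => [|i s ih]; first by rewrite !big_nil derive0.
by rewrite !big_cons polymap_deriveDv // ih polymap_deriveZ.
Qed.

Lemma laplacianD f g x : polymap f -> polymap g ->
  laplacian (fun x => f x + g x) x = laplacian f x + laplacian g x.
Proof.
move=> pf pg; rewrite /laplacian -big_split; apply: eq_bigr => i _ /=.
apply: etrans (congr1 (fun h => 'D_(delta_mx ord0 i) h x)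
  (deriv_add (delta_mx ord0 i) pf pg)) _.
exact: (derive_polyD _ _ (polymap_derive _ pf) (polymap_derive _ pg)).
Qed.

Lemma laplacianZ (k : R) f x : polymap f ->
  laplacian (fun x => k *: f x) x = k *: laplacian f x.
Proof.
move=> pf; rewrite /laplacian scaler_sumr; apply: eq_bigr => i _ /=.
apply: etrans (congr1 (fun h => 'D_(delta_mx ord0 i) h x)
  (deriv_scale k (delta_mx ord0 i) pf)) _.
exact: (derive_polyZ _ _ _ (polymap_derive _ pf)).
Qed.

Lemma laplacianM f g x : polymap f -> polymap g ->
  laplacian (fun x => f x * g x) x = laplacian f x * g x + f x * laplacian g x
  + 2 *: \sum_i 'D_(delta_mx ord0 i) f x * 'D_(delta_mx ord0 i) g x.
Proof.
move=> pf pg; rewrite /laplacian mulr_suml mulr_sumr scaler_sumr -!big_split.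
apply: eq_bigr => i _ /=.
have pdf := polymap_derive (delta_mx ord0 i) pf.
have pdg := polymap_derive (delta_mx ord0 i) pg.
apply: etrans (congr1 (fun h => 'D_(delta_mx ord0 i) h x)
  (deriv_mul (delta_mx ord0 i) pf pg)) _.
apply: etrans (derive_polyD (delta_mx ord0 i) x
  (polymap_mul pdf pg) (polymap_mul pf pdg)) _.
apply: etrans (f_equal2 +%R (derive_polyM (delta_mx ord0 i) x pdf pg)
  (derive_polyM (delta_mx ord0 i) x pf pdg)) _.
have alg (a b c : A) : a + b + (b + c) = a + c + 2 *: b.
  by rewrite scaler_nat mulr2n (addrC b c) addrACA.
exact: alg.
Qed.

Lemma laplacian_mulr f (b : A) x : polymap f ->
  laplacian (fun x => f x * b) x = laplacian f x * b.
Proof.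
move=> pf; rewrite (laplacianM x pf (polymap_cst b)).
have -> : laplacian (fun=> b) x = 0.
  by rewrite /laplacian big1 // => i _; rewrite deriv_cst derive_cst.
rewrite mulr0 addr0 big1 ?scaler0 ?addr0 // => i _.
by rewrite derive_cst mulr0.
Qed.

Lemma iter_laplacian_mulr j f (b : A) : polymap f ->
  iter j (@laplacian R n) (fun x => f x * b) =
  fun x => iter j (@laplacian R n) f x * b.
Proof.
move=> pf; elim: j => //= j ->; apply/funext => x; apply: laplacian_mulr.
exact: polymap_iter_laplacian.
Qed.

Lemma par_delta0 : par (delta_mx ord0 ord0) = 1.
Proof.
rewrite /paravector mxE !eqxx big1 ?addr0 ?scale1r // => l _.
by rewrite mxE /= scale0r.
Qed.

Lemma conj_delta0 : conj (delta_mx ord0 ord0) = 1.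
Proof.
rewrite /paravector_conj mxE !eqxx big1 ?subr0 ?scale1r // => l _.
by rewrite mxE /= scale0r.
Qed.

Lemma par_add_conj x : par x + conj x = (2 * x ord0 ord0)%:A.
Proof.
rewrite /paravector /paravector_conj addrACA subrr addr0 -scalerDl.
by rewrite mulr_natl mulr2n.
Qed.

(** Polarization of [conj_paravectorM]: expand that identity at [x + v]. *)
Lemma conj_mul_par_cross x v :
  conj v * par x + conj x * par v = (2 * \sum_i x ord0 i * v ord0 i)%:A.
Proof.
have mulDD (a b c d : A) : (a + b) * (c + d) = a * c + a * d + (b * c + b * d).
  by rewrite mulrDl !mulrDr.
have := conj_paravectorM (x + v); rewrite !linearD /= mulDD.
rewrite (conj_paravectorM x) (conj_paravectorM v) => H.
have -> : conj v * par x + conj x * par v =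
    (sqn (x + v))%:A - (sqn x)%:A - (sqn v)%:A.
  have subDD (s a b t : A) : s + b + (a + t) - s - t = a + b.
    by rewrite addrAC addrA addrK -(addrA s) (addrC s) addrK addrC.
  by rewrite -H subDD.
rewrite -!scalerBl; congr (_ *: _); rewrite /sqn -!sumrB mulr_sumr.
by apply: eq_bigr => i _; rewrite mxE; ring.
Qed.

End LaplacianAlgebra.

(** * The Laplacian of powers of the paravector *)

Section AppellAlgebra.
Variables (R : realType) (n : nat).
Notation V := 'rV[R]_n.+1.
Notation A := (clifford R n).
Implicit Types (f g : V -> A) (x v : V).
Notation par := (@paravector R n).
Notation conj := (@paravector_conj R n).
Notation d_ i := (delta_mx ord0 i : V).

Lemma sum_coord_delta x i : \sum_j x ord0 j * d_ i ord0 j = x ord0 i.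
Proof.
rewrite (bigD1 i) //= mxE !eqxx mulr1 big1 ?addr0 // => j ji.
by rewrite mxE (negbTE ji) mulr0.
Qed.

Lemma polymap_trace : polymap (fun x => par x + conj x).
Proof. exact: polymap_add (polymap_paravector _ _) (polymap_conj _ _). Qed.

Lemma polymap_norm : polymap (fun x => conj x * par x).
Proof. exact: polymap_mul (polymap_conj _ _) (polymap_paravector _ _). Qed.

Lemma derive_trace v x :
  'D_v (fun x => par x + conj x) x = (2 * v ord0 ord0)%:A.
Proof.
apply: etrans (derive_polyD v x (polymap_paravector _ _) (polymap_conj _ _)) _.
by rewrite derive_paravector derive_conj par_add_conj.
Qed.

Lemma derive_norm v x : 'D_v (fun x => conj x * par x) x =
  conj v * par x + conj x * par v.
Proof.
apply: etrans (derive_polyM v x (polymap_conj _ _) (polymap_paravector _ _)) _.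
by rewrite derive_paravector derive_conj.
Qed.

Lemma laplacian_trace x : laplacian (fun x => par x + conj x) x = 0.
Proof.
rewrite /laplacian big1 // => i _.
have -> : 'D_(d_ i) (fun x => par x + conj x) = cst (2 * d_ i ord0 ord0)%:A.
  by apply/funext => y; exact: derive_trace.
exact: derive_cst.
Qed.

Lemma laplacian_norm x :
  laplacian (fun x => conj x * par x) x = (2 * n.+1%:R)%:A.
Proof.
rewrite /laplacian.
have D2 (i : 'I_n.+1) :
    'D_(d_ i) ('D_(d_ i) (fun x => conj x * par x)) x = 2%:A.
  have -> : 'D_(d_ i) (fun x => conj x * par x) =
      fun x => conj (d_ i) * par x + conj x * par (d_ i).
    by apply/funext => y; exact: derive_norm.
  have pc := polymap_cst (conj (d_ i)); have pp := polymap_cst (par (d_ i)).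
  apply: etrans (derive_polyD (d_ i) x
    (polymap_mul pc (polymap_paravector _ _))
    (polymap_mul (polymap_conj _ _) pp)) _.
  apply: etrans (f_equal2 +%R
    (derive_polyM (d_ i) x pc (polymap_paravector _ _))
    (derive_polyM (d_ i) x (polymap_conj _ _) pp)) _.
  rewrite !derive_cst derive_paravector derive_conj mul0r add0r mulr0 addr0.
  rewrite conj_paravectorM -scalerDl; congr (_ *: _).
  have -> : sqn (d_ i) = 1; last by rewrite -mulr2n.
  rewrite -[RHS](_ : d_ i ord0 i = 1); last by rewrite mxE !eqxx.
  by rewrite -sum_coord_delta; apply: eq_bigr => j _; rewrite expr2.
rewrite (eq_bigr _ (fun i _ => D2 i)) sumr_const card_ord -scaler_nat scalerA.
by rewrite mulrC.
Qed.

(** The trace x + xbar is 2 x_0: it is harmonic and varies in one direction only, so a single cross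
    term of the Leibniz rule survives. *)
Lemma laplacian_traceM f x : polymap f ->
  laplacian (fun x => (par x + conj x) * f x) x =
  (par x + conj x) * laplacian f x + 4 *: 'D_(d_ ord0) f x.
Proof.
move=> pf; apply: etrans (laplacianM x polymap_trace pf) _.
rewrite laplacian_trace mul0r add0r; congr (_ + _).
rewrite (bigD1 ord0) //= big1 => [|i i0].
  rewrite derive_trace mxE !eqxx mulr1 addr0 -scalerAl mul1r scalerA.
  by congr (_ *: _); ring.
by rewrite derive_trace mxE eq_sym (negbTE i0) mulr0 scale0r mul0r.
Qed.

(** Since the i-th partial derivative of xbar x is 2 x_i, the cross terms add up to an Euler
    derivative, in which the direction equals the base point. *)
Lemma laplacian_normM f x : polymap f ->
  laplacian (fun x => conj x * par x * f x) x =
  conj x * par x * laplacian f x + 4 *: 'D_x f x + (2 * n.+1%:R) *: f x.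
Proof.
move=> pf; apply: etrans (laplacianM x polymap_norm pf) _.
rewrite laplacian_norm -scalerAl mul1r -addrA [LHS]addrC; congr (_ + _).
congr (_ + _).
rewrite (derive_coord x x pf) !scaler_sumr; apply: eq_bigr => i _.
rewrite derive_norm conj_mul_par_cross sum_coord_delta -scalerAl mul1r !scalerA.
by congr (_ *: _); ring.
Qed.

(* The coefficient of [t^j] in [(1 - t)^-a]. *)
Definition ris (a j : nat) : R := pochhammer a%:R j / j`!%:R.

Lemma pochhammerS (z : R) j : pochhammer z j.+1 = pochhammer z j * (z + j%:R).
Proof. by rewrite /pochhammer big_ord_recr. Qed.

Lemma pochhammerSl (z : R) j : pochhammer z j.+1 = z * pochhammer (z + 1) j.
Proof.
rewrite /pochhammer big_ord_recl addr0; congr (_ * _).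
by apply: eq_bigr => i _; rewrite /= -natr1 addrAC addrA.
Qed.

Lemma ris0 a : ris a 0 = 1.
Proof. by rewrite /ris /pochhammer big_ord0 fact0 divr1. Qed.

Lemma ris_rec a j : j.+1%:R * ris a j.+1 = (a + j)%:R * ris a j.
Proof.
rewrite /ris pochhammerS factS natrM natrD; field.
by rewrite addrC natr1 !pnatr_eq0 -lt0n fact_gt0.
Qed.

(** Coefficientwise form of (1 - t) (1 - t)^-(a+1) = (1 - t)^-a. *)
Lemma ris_pascal a j : ris a.+1 j.+1 = ris a j.+1 + ris a.+1 j.
Proof.
rewrite /ris pochhammerS (pochhammerSl a%:R) natr1 factS natrM -natr1 -(natr1 j).
by field; rewrite natr1 !pnatr_eq0 -lt0n fact_gt0.
Qed.

(* The coefficient of [t^k] in [(1 - t x)^-a (1 - t xbar)^-b]. *)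
Definition gq (a b k : nat) x : A :=
  \sum_(s < k.+1) (ris a (k - s) * ris b s) *: (par x ^+ (k - s) * conj x ^+ s).

Lemma polymap_gq a b k : polymap (gq a b k).
Proof.
apply: polymap_sum => s; apply: polymap_scale.
by apply: polymap_mul; apply: polymap_exp; constructor.
Qed.

Lemma gq0 a b x : gq a b 0 x = 1.
Proof. by rewrite /gq big_ord1 /= !ris0 !expr0 !mulr1 scale1r. Qed.

Lemma gq_conj_rec a b k x :
  gq a b.+1 k.+1 x = gq a b k.+1 x + gq a b.+1 k x * conj x.
Proof.
rewrite /gq big_ord_recl [in RHS]big_ord_recl !ris0 -addrA; congr (_ + _).
rewrite mulr_suml -big_split /=; apply: eq_bigr => s _.
rewrite /bump /= add1n subSS ris_pascal mulrDr scalerDl; congr (_ + _).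
by rewrite -[RHS]scalerAl; congr (_ *: _); rewrite exprSr mulrA.
Qed.

Lemma gq_par_rec a b k x :
  gq a.+1 b k.+1 x = gq a b k.+1 x + par x * gq a.+1 b k x.
Proof.
rewrite /gq big_ord_recr [in RHS]big_ord_recr /= !subnn !ris0 addrAC.
congr (_ + _).
rewrite mulr_sumr -big_split /=; apply: eq_bigr => s _.
rewrite subSn; last by rewrite -ltnS.
rewrite ris_pascal mulrDl scalerDl; congr (_ + _).
by rewrite -[RHS]scalerAr; congr (_ *: _); rewrite exprS mulrA.
Qed.

(** The sum x + xbar is real, hence central. *)
Lemma par_conj_comm x : GRing.comm (conj x) (par x).
Proof.
have -> : conj x = (2 * x ord0 ord0)%:A - par x.
  by rewrite -par_add_conj addrC addKr.
by rewrite /GRing.comm mulrBl mulrBr -scalerAl -scalerAr mul1r mulr1.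
Qed.

Lemma gq_conj_comm a b k x : gq a b k x * conj x = conj x * gq a b k x.
Proof.
rewrite mulr_suml mulr_sumr; apply: eq_bigr => s _.
rewrite -[LHS]scalerAl -[RHS]scalerAr; congr (_ *: _).
apply/esym; apply: commrM; apply: commrX => //; exact: par_conj_comm.
Qed.

(** Cancelling one factor 1 - t xbar and then one factor 1 - t x. The coefficients x + xbar and xbar
    x that appear are real, which makes their Leibniz rules computable. *)
Lemma gq_rec a b k x : gq a.+1 b.+1 k.+2 x =
  gq a b k.+2 x + (par x + conj x) * gq a.+1 b.+1 k.+1 x
  - conj x * par x * gq a.+1 b.+1 k x.
Proof.
have E j : gq a.+1 b j.+1 x = gq a.+1 b.+1 j.+1 x - gq a.+1 b.+1 j x * conj x.
  by rewrite gq_conj_rec addrK.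
have E' : gq a b k.+2 x = gq a.+1 b k.+2 x - par x * gq a.+1 b k.+1 x.
  by rewrite gq_par_rec addrK.
rewrite E' !E !gq_conj_comm.
set q2 := gq _ _ k.+2 x; set q1 := gq _ _ k.+1 x; set q0 := gq _ _ k x.
have comm : conj x * par x = par x * conj x := par_conj_comm x.
rewrite comm mulrBr (mulrDl (par x)) opprB !mulrA.
have alg (a1 a2 a3 a4 : A) : a1 = a1 - a3 + (a4 - a2) + (a2 + a3) - a4.
  by rewrite -(addrA (a1 - a3)) (addrA (a4 - a2)) subrK (addrC a4) addrA subrK addrK.
exact: alg.
Qed.

(** The coefficient of t in the same identity, where the term of index -1 is absent. *)
Lemma gq_rec1 a b x : gq a.+1 b.+1 1 x = gq a b 1 x + (par x + conj x).
Proof.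
rewrite gq_conj_rec gq_par_rec !gq0 mulr1 mul1r.
exact: esym (addrA _ _ _).
Qed.

End AppellAlgebra.

(** * Laplacians of the generating coefficients and the Appell polynomials *)

Section AppellLaplacian.
Variables (R : realType) (n : nat).
Notation V := 'rV[R]_n.+1.
Notation A := (clifford R n).
Implicit Types (f g : V -> A) (x v : V).
Notation par := (@paravector R n).
Notation conj := (@paravector_conj R n).
Notation d_ i := (delta_mx ord0 i : V).
Notation lap := (@laplacian R n).

(** The usual power rule survives when the derivative commutes with the base. Both directions used
    satisfy this: along the real axis the derivative is 1, and along the point itself it equals the
    base. *)
Lemma derive_polyX f v x (c : A) a : polymap f -> 'D_v f x = c ->
  GRing.comm c (f x) ->
  'D_v (fun y => f y ^+ a) x = a%:R *: (c * f x ^+ a.-1).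
Proof.
move=> pf fc cf; elim: a => [|a ih].
  by rewrite scale0r; exact: derive_cst.
have -> : (fun y => f y ^+ a.+1) = fun y => f y * f y ^+ a.
  by apply/funext => y; rewrite exprS.
apply: etrans (derive_polyM v x pf (polymap_exp a pf)) _.
rewrite fc ih /=; case: a {ih} => [|a].
  by rewrite scale0r mulr0 addr0 scale1r.
rewrite -scalerAr mulrA -cf -mulrA -exprS -[a.+2%:R]natr1 scalerDl scale1r.
by rewrite addrC.
Qed.

Lemma derive0_monomial a s x :
  'D_(d_ ord0) (fun x => par x ^+ a * conj x ^+ s) x =
  a%:R *: (par x ^+ a.-1 * conj x ^+ s) + s%:R *: (par x ^+ a * conj x ^+ s.-1).
Proof.
have pp := polymap_paravector R n; have pc := polymap_conj R n.
apply: etrans (derive_polyM _ x (polymap_exp a pp) (polymap_exp s pc)) _.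
rewrite (derive_polyX a pp (etrans (derive_paravector _ _) (par_delta0 _ _))).
  rewrite (derive_polyX s pc (etrans (derive_conj _ _) (conj_delta0 _ _))).
    by rewrite !mul1r -[X in X + _]scalerAl -[X in _ + X]scalerAr.
  exact: commr_sym (commr1 _).
exact: commr_sym (commr1 _).
Qed.

Lemma derive_euler_monomial a s x :
  'D_x (fun x => par x ^+ a * conj x ^+ s) x =
  (a + s)%:R *: (par x ^+ a * conj x ^+ s).
Proof.
have pp := polymap_paravector R n; have pc := polymap_conj R n.
apply: etrans (derive_polyM _ x (polymap_exp a pp) (polymap_exp s pc)) _.
rewrite (derive_polyX a pp (derive_paravector x x)); last exact: commr_refl.
rewrite (derive_polyX s pc (derive_conj x x)); last exact: commr_refl.
have E (y : A) k : k%:R *: (y * y ^+ k.-1) = k%:R *: y ^+ k.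
  by case: k => [|k]; rewrite ?scale0r // -exprS.
by rewrite !E -[X in X + _]scalerAl -[X in _ + X]scalerAr natrD scalerDl.
Qed.

Lemma polymap_monomial a s : polymap (fun x => par x ^+ a * conj x ^+ s).
Proof. by apply: polymap_mul; apply: polymap_exp; constructor. Qed.

Lemma derive_gq a b k v x : 'D_v (gq a b k) x =
  \sum_(s < k.+1) (ris R a (k - s) * ris R b s) *:
     'D_v (fun x => par x ^+ (k - s) * conj x ^+ s) x.
Proof.
apply: etrans (derive_poly_sum _ v x (fun s : 'I_k.+1 => polymap_scale
  (ris R a (k - s) * ris R b s) (polymap_monomial (k - s) s))) _.
apply: eq_bigr => s _; apply: derive_polyZ; exact: polymap_monomial.
Qed.

Lemma derive0_gq a b k x :
  'D_(d_ ord0) (gq a b k.+1) x = (a + b + k)%:R *: gq a b k x.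
Proof.
rewrite derive_gq.
under eq_bigr do rewrite derive0_monomial scalerDr !scalerA.
(* The x-part vanishes at [s = k.+1] and the xbar-part at [s = 0]. Without these ends both sums run
   over [s <= k], where [ris_rec] gives the factors a + (k - s) and b + s, with sum a + b + k. *)
rewrite big_split /= big_ord_recr [X in _ + X]big_ord_recl /=.
rewrite subnn !mulr0 !scale0r addr0 add0r -big_split /gq scaler_sumr /=.
apply: eq_bigr => s _; rewrite /bump /= add1n subSS.
have sk : (s <= k)%N by rewrite -ltnS.
rewrite subSn // -scalerDl scalerA; congr (_ *: _).
have := ris_rec R a (k - s); have := ris_rec R b s.
move=> e1 e2; rewrite mulrAC (mulrC (ris R a (k - s).+1)) e2.
rewrite -mulrA (mulrC (ris R b s.+1)) e1 !natrD natrB //; ring.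
Qed.

Lemma derive_euler_gq a b k x : 'D_x (gq a b k) x = k%:R *: gq a b k x.
Proof.
rewrite derive_gq scaler_sumr; apply: eq_bigr => s _.
rewrite derive_euler_monomial subnK; last by rewrite -ltnS.
by rewrite !scalerA mulrC.
Qed.

Lemma laplacian_cst (a : A) x : lap (fun=> a) x = 0.
Proof. by rewrite /laplacian big1 // => i _; rewrite deriv_cst derive_cst. Qed.

Lemma laplacian_gq0 a b x : lap (gq a b 0) x = 0.
Proof.
have -> : gq a b 0 = fun _ : V => 1 by apply/funext => y; exact: gq0.
exact: laplacian_cst.
Qed.

Lemma laplacian_gq1 a b x : lap (gq a b 1) x = 0.
Proof.
have -> : gq a b 1 = fun y => ris R a 1 *: par y + ris R b 1 *: conj y.
  apply/funext => y; rewrite /gq big_ord_recr big_ord1 /= !ris0.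
  by rewrite !expr0 !expr1 !mulr1 !mul1r.
rewrite /laplacian big1 // => i _.
have pp := polymap_scale (ris R a 1) (polymap_paravector R n).
have pc := polymap_scale (ris R b 1) (polymap_conj R n).
have -> : 'D_(d_ i) (fun y => ris R a 1 *: par y + ris R b 1 *: conj y) =
    cst (ris R a 1 *: par (d_ i) + ris R b 1 *: conj (d_ i)).
  apply/funext => y; apply: etrans (derive_polyD _ y pp pc) _.
  apply: etrans (f_equal2 +%R
    (derive_polyZ _ (d_ i) y (polymap_paravector R n))
    (derive_polyZ _ (d_ i) y (polymap_conj R n))) _.
  by rewrite derive_paravector derive_conj.
exact: derive_cst.
Qed.

Definition lap_coef (m : nat) : R := - 2 * m.+1%:R * (n%:R - 1 - 2 * m%:R).

(* [r j] stands for [gq m (m-1) j.+2], which is 0 when [m = 0]. *)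
Lemma laplacian_gq_step m k x (mu : R) (r : nat -> V -> A) :
  (forall j, polymap (r j)) ->
  (forall j y, lap (r j) y = mu *: gq m.+1 m j y) ->
  (forall j y, gq m.+1 m j.+2 y = r j y + (par y + conj y) * gq m.+1 m j.+1 y
    - conj y * par y * gq m.+1 m j y) ->
  mu + (8 * m%:R + 4 - 2 * n.+1%:R) = lap_coef m ->
  lap (gq m.+1 m k.+2) x = lap_coef m *: gq m.+2 m.+1 k x.
Proof.
move=> pr lr qr mE.
pose Q j := gq m.+1 m j : V -> A; pose Z j := gq m.+2 m.+1 j : V -> A.
have pQ j : polymap (Q j) by exact: polymap_gq.
(* The trace contributes 4 (2m + 1 + j) times [Q j] and the norm takes away 4j + 2(n + 1) times it.
   The index j cancels, which leaves the constant in the hypothesis on [mu]. *)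
have rec j y : lap (Q j.+2) y = lap_coef m *: Q j y
    + (par y + conj y) * lap (Q j.+1) y - conj y * par y * lap (Q j) y.
  have -> : Q j.+2 = fun y => (r j y + (par y + conj y) * Q j.+1 y)
      + (-1) *: (conj y * par y * Q j y).
    by apply/funext => z; rewrite scaleN1r; exact: qr.
  have pt := polymap_mul (polymap_trace R n) (pQ j.+1).
  have pn := polymap_mul (polymap_norm R n) (pQ j).
  apply: etrans (laplacianD y (polymap_add (pr j) pt) (polymap_scale (-1) pn)) _.
  apply: etrans (f_equal2 +%R (laplacianD y (pr j) pt) (laplacianZ (-1) y pn)) _.
  rewrite lr (laplacian_traceM y (pQ j.+1)) (laplacian_normM y (pQ j)).
  rewrite /Q derive0_gq derive_euler_gq -/(Q j) -/(Q j.+1) -mE.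
  set T := _ * lap (Q j.+1) y; set U := _ * lap (Q j) y; set q := Q j y.
  have alg (t u w : A) (c1 c2 c3 c4 : R) :
      c1 *: w + (t + c2 *: w) + (-1) *: (u + c3 *: w + c4 *: w) =
      (c1 + (c2 - c3 - c4)) *: w + t - u.
    by apply/ffunP => D; rewrite !ffunE /GRing.scale /=; ring.
  rewrite !scalerA alg; congr (_ *: _ + _ - _); congr (_ + _).
  by rewrite !natrD -!natr1; ring.
(* After division by [lap_coef m], the Laplacians obey the recurrence of [Z]. It reaches two steps
   back, hence strong induction; degrees 0 and 1 are harmonic and start it. *)
elim/ltn_ind: k => -[|[|k]] ih; first 1 last.
- have E0 : lap (Q 2) x = lap_coef m *: Z 0 x := ih 0%N isT.
  rewrite [LHS](rec 1%N x) E0 laplacian_gq1 mulr0 subr0 -scalerAr -scalerDr.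
  by rewrite /Z gq0 mulr1 gq_rec1.
- have E1 : lap (Q k.+3) x = lap_coef m *: Z k.+1 x by apply: ih.
  have E0 : lap (Q k.+2) x = lap_coef m *: Z k x by apply: ih.
  rewrite [LHS](rec k.+2 x) E1 E0 -!scalerAr -scalerDr -scalerBr.
  by rewrite /Z gq_rec.
- rewrite [LHS](rec 0%N x) laplacian_gq1 laplacian_gq0 !mulr0 addr0 subr0.
  by rewrite /Q !gq0.
Qed.

Lemma gq_power k x : gq 1 0 k x = par x ^+ k.
Proof.
rewrite /gq big_ord_recl big1 ?addr0 => [|s _].
  rewrite subn0 ris0 mulr1 expr0 mulr1 -[RHS]scale1r; congr (_ *: _).
  elim: k => [|k ih]; first exact: ris0.
  have := ris_rec R 1 k; rewrite add1n ih => /mulfI; apply.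
  by rewrite pnatr_eq0.
by rewrite /ris pochhammerSl !mul0r mulr0 scale0r.
Qed.

Lemma laplacian_gq m k x :
  lap (gq m.+1 m k.+2) x = lap_coef m *: gq m.+2 m.+1 k x.
Proof.
elim: m k x => [|m ih] k x.
  apply: (@laplacian_gq_step 0 k x 0 (fun _ _ => 0)).
  - by move=> j; exact: polymap_cst.
  - by move=> j y; rewrite scale0r laplacian_cst.
  - move=> j y; rewrite !gq_power mulrDl -exprS add0r.
    by rewrite -mulrA -exprS addrK.
  - by rewrite /lap_coef -natr1; ring.
apply: (@laplacian_gq_step m.+1 k x (lap_coef m) (fun j => gq m.+1 m j.+2)).
- by move=> j; exact: polymap_gq.
- by move=> j y; exact: ih.
- by move=> j y; exact: gq_rec.
- by rewrite /lap_coef -!natr1; ring.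
Qed.

Lemma iter_laplacian_power m k :
  iter m lap (fun x => par x ^+ (k + m.*2)) =
  fun x => (\prod_(i < m) lap_coef i) *: gq m.+1 m k x.
Proof.
elim: m k => [|m ih] k.
  by apply/funext => x; rewrite addn0 big_ord0 scale1r gq_power.
have -> : (k + m.+1.*2 = k.+2 + m.*2)%N by rewrite doubleS !addnS !addSn.
rewrite /= ih; apply/funext => x.
rewrite laplacianZ; last exact: polymap_gq.
by rewrite laplacian_gq scalerA big_ord_recr.
Qed.

(** Some iterate reaches a multiple of a generating coefficient of degree 0 or 1, and these are
    harmonic. *)
Lemma iter_laplacian_power_small m k x : (k < m.*2)%N ->
  iter m lap (fun x => par x ^+ k) x = 0.
Proof.
elim: m x => // m ih x; rewrite doubleS !ltnS => km /=.
have [kd|] := ltnP k m.*2.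
  have -> : iter m lap (fun x => par x ^+ k) = fun=> 0.
    by apply/funext => y; exact: ih.
  exact: laplacian_cst.
move=> dk; have -> : (k = (k - m.*2) + m.*2)%N by rewrite subnK.
rewrite iter_laplacian_power laplacianZ; last exact: polymap_gq.
have : (k - m.*2 <= 1)%N by rewrite leq_subLR addn1.
by case: (k - m.*2)%N => [|[|//]] _; rewrite ?laplacian_gq0 ?laplacian_gq1 scaler0.
Qed.

(** For n = 2m + 1 the parameters (n + 1)/2 and (n - 1)/2 are m + 1 and m, so the terms agree up to
    the factorials in the binomial coefficient. *)
Lemma gq_appell m k x : n = m.*2.+1 -> gq m.+1 m k x =
  (pochhammer n%:R k / k`!%:R) *: appell_poly k x.
Proof.
move=> nE; rewrite /gq /appell_poly scaler_sumr; apply: eq_bigr => s _.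
rewrite scalerA; congr (_ *: _).
have half1 : (n%:R + 1) / 2 = m.+1%:R :> R.
  by rewrite nE -!natr1 -addnn natrD; field.
have half0 : (n%:R - 1) / 2 = m%:R :> R.
  by rewrite nE -!natr1 -addnn natrD; field.
rewrite /appell_coef half1 half0 /ris.
have sk : (s <= k)%N by rewrite -ltnS.
have := bin_fact sk => /(congr1 (fun i => i%:R : R)); rewrite !natrM => bf.
have p0 : pochhammer n%:R k != 0 :> R.
  by apply/prodf_neq0 => i _; rewrite -natrD pnatr_eq0 nE addSn.
have f0 i : i`!%:R != 0 :> R by rewrite pnatr_eq0 -lt0n fact_gt0.
rewrite -bf; field.
by rewrite p0 !f0 pnatr_eq0 -lt0n bin_gt0.
Qed.

(* At the point 1 Euler's identity and the Appell property give a recurrence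
   in [k], which replaces the Chu-Vandermonde identity. *)
Lemma gq_delta0 a b k : gq a b k (d_ ord0) = (ris R (a + b) k)%:A.
Proof.
elim: k => [|k ih]; first by rewrite gq0 ris0 scale1r.
have k0 : k.+1%:R != 0 :> R by rewrite pnatr_eq0.
apply: (scalerI k0); rewrite -derive_euler_gq derive0_gq ih !scalerA.
by rewrite ris_rec.
Qed.

(** Both sides of [gq_appell] are evaluated at the point 1, where every monomial is 1. *)
Lemma sum_appell_coef m k : n = m.*2.+1 ->
  \sum_(s < k.+1) appell_coef R n k s = 1.
Proof.
move=> nE; have E : appell_poly k (d_ ord0) =
    (\sum_(s < k.+1) appell_coef R n k s)%:A :> A.
  rewrite scaler_suml; apply: eq_bigr => s _.
  by rewrite par_delta0 conj_delta0 !expr1n mulr1.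
have := gq_delta0 m.+1 m k; rewrite (gq_appell _ _ nE) E.
have -> : (m.+1 + m = n)%N by rewrite nE addSn addnn.
rewrite /ris scalerA => /eqP; rewrite -subr_eq0 -scalerBl scaler_eq0 oner_eq0.
rewrite orbF subr_eq0 => /eqP H.
have p0 : pochhammer n%:R k / k`!%:R != 0 :> R.
  rewrite mulf_neq0 ?invr_neq0 ?pnatr_eq0 -?lt0n ?fact_gt0 //.
  by apply/prodf_neq0 => i _; rewrite -natrD pnatr_eq0 nE addSn.
by apply: (mulfI p0); rewrite mulr1.
Qed.

Lemma appell_coef_ge0 m k s : n = m.*2.+1 -> 0 <= appell_coef R n k s.
Proof.
move=> nE; have p0 (z : R) j : 0 <= z -> 0 <= pochhammer z j.
  by move=> z0; apply: prodr_ge0 => i _; rewrite addr_ge0.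
have n0 : 0 <= (n%:R - 1) / 2 :> R by rewrite nE -natr1 addrK divr_ge0.
have n1 : 0 <= (n%:R + 1) / 2 :> R by rewrite divr_ge0 // addr_ge0.
by rewrite /appell_coef mulr_ge0 ?invr_ge0 ?p0 // !mulr_ge0 ?p0.
Qed.

(** The Appell coefficients are nonnegative with sum 1, so this is a convex combination of terms of
    norm exactly |x|^k |a|. No constant is lost, and one convergence lemma serves both spaces. *)
Lemma norm_appell_polyM m k x (a : A) : n = m.*2.+1 ->
  `|appell_poly k x * a| <= `|par x| ^+ k * `|a|.
Proof.
move=> nE; rewrite mulr_suml; apply: le_trans (ler_norm_sum _ _ _) _.
rewrite -[leRHS]mul1r -(sum_appell_coef k nE) mulr_suml.
apply: ler_sum => s _; rewrite -[X in `|X|]scalerAl normrZ.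
rewrite ger0_norm ?(appell_coef_ge0 _ _ nE) // -(mulrA _ _ a) norm_paravectorX.
rewrite paravector_conjE norm_paravectorX norm_row_conj (mulrA (`|par x| ^+ (k - s))) -exprD subnK //.
by rewrite -ltnS.
Qed.


End AppellLaplacian.

(** * Weighted series and their domains *)

Section WeightedSeries.
Variables (R : realType) (n : nat).
Notation V := 'rV[R]_n.+1.
Notation A := (clifford R n).
Implicit Types (x y v : V) (d : nat -> R) (a : nat -> A).
Notation par := (@paravector R n).
Notation N := (fun x : V => `|par x|).

Lemma nneseries_ltyP (u : nat -> R) : (forall k, 0 <= u k) ->
  (\sum_(0 <= k <oo) (u k)%:E < +oo)%E <->
  exists S, forall M, \sum_(k < M) u k <= S.
Proof.
move=> u0; split=> [ulty|[S uS]].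
  have cu := nnseries_is_cvg u0 ulty.
  exists (limn (series u)) => M.
  have := nondecreasing_cvgn_le (nondecreasing_series (fun k _ _ => u0 k)) cu M.
  by rewrite /series /= big_mkord.
apply: (@le_lt_trans _ _ S%:E); last exact: ltry.
apply: lime_le.
  by apply: is_cvg_nneseries => k _ _; rewrite lee_fin.
by near=> M; rewrite sumEFin lee_fin big_mkord.
Unshelve. all: by end_near. Qed.

Lemma geometric_partial_sum_le (t : R) M : 0 <= t < 1 ->
  \sum_(k < M) t ^+ k <= (1 - t)^-1.
Proof.
move=> /andP[t0 t1]; have t1' : 0 < 1 - t by rewrite subr_gt0.
rewrite -[(1 - t)^-1]mul1r ler_pdivlMr // [leLHS]mulrC.
by rewrite -[1 - t]opprB mulNr -subrX1 opprB lerBlDr lerDl exprn_ge0.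
Qed.

Definition geom_bounded d (rho : R) :=
  0 < rho /\ exists B, forall k, rho ^+ (2 * k) <= B * d k.

(** The domain may contain points of its bounding sphere, so convergence at a point alone gives no
    larger radius. An interior point can be pushed outward within the domain, and bounded terms
    there give an admissible radius; conversely, below such a radius the series is dominated by a
    geometric one. *)
Lemma interior_series_domain d : (forall k, 0 < d k) ->
  interior (series_domain n d) = radial (geom_bounded d).
Proof.
move=> d0; have t0 x k : 0 <= N x ^+ (2 * k) / d k.
  by rewrite divr_ge0 ?exprn_ge0 // ltW.
apply/seteqP; split=> x.
- move=> /nbhs_ballP[e /= e0 xe].
  (* Moving along the real axis away from 0 increases the norm. *)
  pose w : V := delta_mx ord0 ord0.
  (* This denominator keeps [s *: w] shorter than [e] in the norm of row vectors, without computing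
     the norm of [w]. The sign of [s] below follows that of x_0. *)
  have w1 : 0 < 2 * (`|w| + 1) by rewrite mulr_gt0 // ltr_wpDl.
  pose t := e / (2 * (`|w| + 1)).
  have tpos : 0 < t by rewrite divr_gt0.
  pose s := if 0 <= x ord0 ord0 then t else - t.
  have st : `|s| = t.
    by rewrite /s; case: ifP => _; rewrite ?normrN gtr0_norm.
  have sx : 0 <= s * x ord0 ord0.
    rewrite /s; case: ifPn => h; first by rewrite mulr_ge0 // ltW.
    by rewrite mulNr -mulrN mulr_ge0 ?(ltW tpos) // oppr_ge0 ltW // ltNge.
  have xy : N x < N (x + s *: w).
    rewrite -(ltr_pXn2r (ltn0Sn 1)) ?nnegrE // !sqr_norm_paravector -subr_gt0.
    have -> : sqn (x + s *: w) - sqn x = 2 * (s * x ord0 ord0) + s ^+ 2.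
      rewrite /sqn -sumrB (bigD1 ord0) //= big1 => [|i i0].
        by rewrite !mxE !eqxx mulr1; ring.
      by rewrite !mxE (negbTE i0) mulr0; ring.
    apply: ltr_wpDl; first by rewrite mulr_ge0.
    by rewrite exprn_even_gt0 //= -normr_gt0 st.
  have yD : series_domain n d (x + s *: w).
    apply: xe; rewrite -ball_normE /= opprD addNKr normrN normrZ st /t.
    rewrite mulrAC ltr_pdivrMr // ltr_pM2l // mulrDr mulr1.
    by have := normr_ge0 w; lra.
  have /(nneseries_ltyP (t0 _))[S HS] := yD.
  exists (N (x + s *: w)) => //; split; first exact: le_lt_trans xy.
  exists S => k; rewrite -ler_pdivrMr //; apply: le_trans (HS k.+1).
  by rewrite big_ord_recr /= lerDr; apply: sumr_ge0.
- move=> [rho [rho0 [B HB]] xrho].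
  apply: filterS (nbhs_norm_paravector_lt xrho) => y /= yrho.
  apply/(nneseries_ltyP (t0 y)).
  pose th := (N y / rho) ^+ 2.
  have th01 : 0 <= th < 1.
    rewrite sqr_ge0 /= expr_lt1 // ?divr_ge0 ?(ltW rho0) //.
    by rewrite ltr_pdivrMr // mul1r.
  have B0 : 0 <= B.
    have := HB 0%N; rewrite muln0 expr0 => h.
    by rewrite -(pmulr_lge0 _ (d0 0%N)) (le_trans ler01).
  exists (B * (1 - th)^-1) => M.
  apply: le_trans (ler_wpM2l B0 (geometric_partial_sum_le M th01)).
  rewrite mulr_sumr; apply: ler_sum => k _.
  rewrite ler_pdivrMr // /th -exprM expr_div_n mulrA [leRHS]mulrAC.
  rewrite ler_pdivlMr ?exprn_gt0 // (mulrC B) -[leRHS]mulrA.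
  by apply: ler_wpM2l; rewrite ?exprn_ge0.
Qed.

Lemma weighted_l2P d a : (forall k, 0 < d k) ->
  weighted_l2 d a <-> exists S, forall M, \sum_(k < M) d k * `|a k| ^+ 2 <= S.
Proof.
by move=> d0; apply: nneseries_ltyP => k; rewrite mulr_ge0 ?sqr_ge0 // ltW.
Qed.

(** Holds at every point of the domain, boundary included, as membership in [series_space] requires;
    the locally uniform bounds are available only inside. *)
Lemma cvg_weighted_series d a (p : nat -> V -> A) x : (forall k, 0 < d k) ->
  weighted_l2 d a -> series_domain n d x ->
  (forall k, `|p k x * a k| <= N x ^+ k * `|a k|) ->
  cvgn (series (fun k => p k x * a k)).
Proof.
move=> d0 /(weighted_l2P _ d0)[S HS] xD pN.
have t0 k : 0 <= N x ^+ (2 * k) / d k by rewrite divr_ge0 ?exprn_ge0 // ltW.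
have /(nneseries_ltyP t0)[T HT] := xD.
apply: (@cvg_series_clifford _ _ _
  (fun k => N x ^+ (2 * k) / d k + d k * `|a k| ^+ 2) (T + S)) => [k|M].
  apply: le_trans (pN k) _; set u := N x ^+ k; set w := `|a k|.
  have := d0 k; set e := d k => e0.
  have -> : N x ^+ (2 * k) = u ^+ 2 by rewrite mulnC exprM.
  have -> : u ^+ 2 / e + e * w ^+ 2 = (u ^+ 2 + (e * w) ^+ 2) / e.
    by field; rewrite gt_eqF.
  rewrite ler_pdivlMr // -subr_ge0.
  have -> : u ^+ 2 + (e * w) ^+ 2 - u * w * e =
    ((u - e * w) ^+ 2 + (u ^+ 2 + (e * w) ^+ 2)) / 2 by field.
  by rewrite divr_ge0 // !addr_ge0 // sqr_ge0.
by rewrite big_split; exact: lerD.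
Qed.

Lemma dominated_power_series d a : (forall k, 0 < d k) -> weighted_l2 d a ->
  dominated (geom_bounded d) id (fun k => mul_const R n * `|a k| * 1)
    (fun k x => par x ^+ k * a k).
Proof.
move=> d0 /(weighted_l2P _ d0)[S HS].
have pX k : polymap (fun x => par x ^+ k).
  by apply: polymap_exp; exact: polymap_paravector.
split=> [k|k|m k|rho r [rho0 [B HB]] /andP[r0 rrho]].
- exact: polymap_mul (pX k) (polymap_cst _).
- by rewrite !mulr_ge0 ?mul_const_ge0.
- apply: tame_mulr => //; elim: k => [|k ih].
    have -> : (fun x => par x ^+ 0) = fun=> 1 by apply/funext => x; rewrite expr0.
    by rewrite -[X in tame _ _ X _](norm1 R n); exact: tame_cst.
  have -> : (fun x => par x ^+ k.+1) = fun x => par x * par x ^+ k.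
    by apply/funext => x; rewrite exprS.
  exact: tame_paravectorM.
have B0 : 0 <= B.
  have := HB 0%N; rewrite muln0 expr0 => h.
  by rewrite -(pmulr_lge0 _ (d0 0%N)) (le_trans ler01).
(* The bounds rho^(2k) <= B d_k and d_k |a_k|^2 <= S multiply to |a_k|^2 rho^(2k) <= B S, so at any
   radius r < rho the terms decay geometrically. *)
have aB k : `|a k| * rho ^+ k <= Num.sqrt (B * S).
  rewrite -[leLHS]ger0_norm ?mulr_ge0 ?exprn_ge0 ?(ltW rho0) // -sqrtr_sqr.
  apply: ler_wsqrtr; rewrite exprMn -exprM [(k * 2)%N]mulnC.
  apply: le_trans (ler_wpM2l (sqr_ge0 _) (HB k)) _.
  rewrite mulrCA; apply: ler_wpM2l => //; rewrite mulrC.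
  apply: le_trans (HS k.+1); rewrite big_ord_recr /= lerDr.
  by apply: sumr_ge0 => i _; rewrite mulr_ge0 ?sqr_ge0 // ltW.
have th01 : 0 <= r / rho < 1.
  by rewrite divr_ge0 ?(ltW rho0) //= ltr_pdivrMr // mul1r.
have := mul_const_ge0 R n; move: (mul_const R n) => mc mc0.
exists (mc * Num.sqrt (B * S) * (1 - r / rho)^-1) => M.
have K0 : 0 <= mc * Num.sqrt (B * S) by rewrite mulr_ge0 ?sqrtr_ge0.
apply: le_trans (ler_wpM2l K0 (geometric_partial_sum_le M th01)).
rewrite mulr_sumr; apply: ler_sum => k _.
have -> : mc * `|a k| * 1 * r ^+ k = mc * (`|a k| * rho ^+ k * (r / rho) ^+ k).
  rewrite expr_div_n; field; rewrite expf_neq0 // gt_eqF //.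
rewrite -[leRHS]mulrA; apply: ler_wpM2l => //.
by apply: ler_wpM2r => //; have /andP[+ _] := th01; exact: exprn_ge0.
Qed.

End WeightedSeries.

Lemma binomial_term_le (R : realType) (r d : R) m j : 0 <= r -> 0 <= d ->
  (j <= m)%N -> 'C(m, j)%:R * (r ^+ j * d ^+ (m - j)) <= (r + d) ^+ m.
Proof.
move=> r0 d0 jm; rewrite addrC exprDn.
have jm' : (j < m.+1)%N by [].
rewrite (bigD1 (Ordinal jm')) //= mulr_natl [r ^+ j * _]mulrC lerDl.
by apply: sumr_ge0 => i _; rewrite mulrn_wge0 // mulr_ge0 // exprn_ge0.
Qed.

(** * Comparison of the two weights and transfer of coefficients *)

Section FueterSce.
Variables (R : realType) (n h : nat) (nE : n = h.*2.+1) (c b : nat -> R).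
Hypotheses (c_ge1 : forall k, 1 <= c k)
  (bE : forall k, b k = c (k + h.*2)%N * (k`!%:R / (k + h.*2)`!%:R) ^+ 2).
Notation V := 'rV[R]_n.+1.
Notation A := (clifford R n).
Notation par := (@paravector R n).
Notation lap := (@laplacian R n).

Let c_gt0 k : 0 < c k. Proof. exact: lt_le_trans (c_ge1 k). Qed.

Let fact_neq0 i : i`!%:R != 0 :> R.
Proof. by rewrite pnatr_eq0 -lt0n fact_gt0. Qed.

Lemma weight_gt0 k : 0 < b k.
Proof. by rewrite bE mulr_gt0 // exprn_gt0 // divr_gt0 // ltr0n fact_gt0. Qed.

Lemma weight_le k : b k <= c (k + h.*2)%N.
Proof.
rewrite bE ler_piMr ?(ltW (c_gt0 _)) // expr_le1 // ?divr_ge0 //.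
by rewrite ler_pdivrMr ?ltr0n ?fact_gt0 // mul1r ler_nat leq_fact // leq_addr.
Qed.

(** From c to b, the factor (k + 2h)!/k! is absorbed by shrinking the radius. From b to c,
    [weight_le] suffices beyond the first 2h indices. *)
Lemma radial_weight : radial (geom_bounded c) = radial (geom_bounded b) :> set V.
Proof.
apply/seteqP; split=> x [rho [rho0 [B HB]] xrho].
- pose r := (`|par x| + rho) / 2.
  have [xr rrho] : `|par x| < r /\ r < rho by rewrite /r; split; lra.
  have r0 : 0 < r by exact: le_lt_trans xr.
  have d0 : 0 < rho - r by rewrite subr_gt0.
  (* This constant comes from keeping one term of the expansion of (r + (rho - r))^(k + 2h): C(k+2h,
     k) r^k (rho - r)^(2h) <= rho^(k + 2h). *)
  pose K : R := (h.*2)`!%:R / (rho - r) ^+ h.*2.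
  have K0 : 0 <= K by rewrite divr_ge0 // exprn_ge0 // ltW.
  exists r => //; split=> //; exists (K ^+ 2 * B) => k.
  pose F : R := (k + h.*2)`!%:R / k`!%:R.
  have FE : F = 'C(k + h.*2, k)%:R * (h.*2)`!%:R.
    have := bin_fact (leq_addr h.*2 k); rewrite addKn /F => <-.
    by rewrite !natrM; field.
  have key : F * r ^+ k <= K * rho ^+ (k + h.*2).
    have := binomial_term_le (ltW r0) (ltW d0) (leq_addr h.*2 k).
    rewrite addKn (addrC r) subrK => H.
    rewrite /K [leRHS]mulrAC ler_pdivlMr ?exprn_gt0 // FE.
    have := ler_wpM2l (ler0n R (h.*2)`!) H.
    by rewrite [leLHS](_ : _ = 'C(k + h.*2, k)%:R * (h.*2)`!%:R * r ^+ k
      * (rho - r) ^+ h.*2) //; ring.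
  have F0 : F != 0 by rewrite mulf_neq0 ?invr_neq0.
  have -> : K ^+ 2 * B * b k = K ^+ 2 * (B * c (k + h.*2)%N) / F ^+ 2.
    by rewrite bE /F; field; rewrite !fact_neq0.
  rewrite ler_pdivlMr ?exprn_even_gt0 //.
  have sq : (F * r ^+ k) ^+ 2 <= (K * rho ^+ (k + h.*2)) ^+ 2.
    apply: lerXn2r key; rewrite nnegrE mulr_ge0 ?exprn_ge0 // ?(ltW r0) ?(ltW rho0) //.
    by rewrite divr_ge0.
  rewrite (mulnC 2) exprM mulrC -exprMn; apply: le_trans sq _.
  rewrite exprMn -exprM (mulnC _ 2); apply: ler_wpM2l; first exact: sqr_ge0.
  exact: HB.
- have B0 : 0 <= B.
    have := HB 0%N; rewrite muln0 expr0 => hB.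
    by rewrite -(pmulr_lge0 _ (weight_gt0 0)) (le_trans ler01).
  have rhoX i : 0 <= rho ^+ i by rewrite exprn_ge0 // ltW.
  exists rho => //; split=> //.
  (* The finite sum serves the indices below [h.*2], about which b says nothing; there [c k >= 1] is
     enough. *)
  exists (rho ^+ (2 * h.*2) * B + \sum_(i < h.*2) rho ^+ (2 * i)) => k.
  have [kh|hk] := ltnP k h.*2.
    apply: (@le_trans _ _ (\sum_(i < h.*2) rho ^+ (2 * i))).
      rewrite (bigD1 (Ordinal kh)) //= lerDl; exact: sumr_ge0.
    rewrite mulrDl; apply: ler_wpDl; first by rewrite !mulr_ge0 // ltW.
    by rewrite ler_peMr ?sumr_ge0.
  rewrite mulrDl; apply: ler_wpDr.
    by rewrite mulr_ge0 ?sumr_ge0 // ltW.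
  rewrite -(subnK hk) mulnDr exprD mulrC -mulrA; apply: ler_wpM2l => //.
  by apply: le_trans (HB _) _; apply: ler_wpM2l => //; exact: weight_le.
Qed.

Definition fueter_const : R := \prod_(i < h) lap_coef R n i.

Lemma fueter_const_neq0 : fueter_const != 0.
Proof.
apply/prodf_neq0 => i _; rewrite /lap_coef !mulf_neq0 ?oppr_eq0 ?pnatr_eq0 //.
have -> : n%:R - 1 - 2 * i%:R = (2 * (h - i))%:R :> R.
  by rewrite nE natrM natrB 1?ltnW // -natr1 -mul2n natrM; ring.
by rewrite pnatr_eq0 muln_eq0 /= subn_eq0 -ltnNge.
Qed.

Definition coef_ratio j : R := fueter_const * (pochhammer n%:R j / j`!%:R).

(** As n = 2h + 1, the rising factorial continues (2h)! where it stops. *)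
Lemma pochhammer_fact j :
  pochhammer n%:R j * (h.*2)`!%:R = (j + h.*2)`!%:R :> R.
Proof.
elim: j => [|j ih]; first by rewrite /pochhammer big_ord0 mul1r.
rewrite pochhammerS mulrAC ih addSn factS natrM mulrC; congr (_ * _).
by rewrite nE -natrD addSn addnC.
Qed.

Lemma coef_ratio_neq0 j : coef_ratio j != 0.
Proof.
rewrite mulf_neq0 ?fueter_const_neq0 // mulf_neq0 ?invr_neq0 //.
by apply: contra_eq_neq (pochhammer_fact j) => ->; rewrite mul0r eq_sym.
Qed.

Lemma weight_coef_ratio j :
  b j * coef_ratio j ^+ 2 = c (j + h.*2)%N * (fueter_const / (h.*2)`!%:R) ^+ 2.
Proof. 
rewrite bE /coef_ratio -pochhammer_fact; field.
rewrite !fact_neq0 /=.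
by apply: contra_eq_neq (pochhammer_fact j) => ->; rewrite mul0r eq_sym.
Qed.

Lemma iter_laplacian_term j (be : A) x :
  iter h lap (fun x => par x ^+ (j + h.*2) * be) x =
  appell_poly j x * (coef_ratio j *: be).
Proof.
have pX : polymap (fun x : V => par x ^+ (j + h.*2)).
  by apply: polymap_exp; exact: polymap_paravector.
rewrite (iter_laplacian_mulr h be pX) iter_laplacian_power (gq_appell _ _ nE).
by rewrite scalerA -[LHS]scalerAl scalerAr.
Qed.

Lemma iter_laplacian_term_small k (be : A) x : (k < h.*2)%N ->
  iter h lap (fun x => par x ^+ k * be) x = 0.
Proof.
move=> kh; have pX : polymap (fun x : V => par x ^+ k).
  by apply: polymap_exp; exact: polymap_paravector.
by rewrite (iter_laplacian_mulr h be pX) iter_laplacian_power_small // mul0r.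
Qed.

Variables (al be : nat -> A).
Hypothesis al_be : forall j, al j = coef_ratio j *: be (j + h.*2)%N.

Lemma fueter_sce_series (f : V -> A) (l : A) x : weighted_l2 c be ->
  (forall y, series_domain n c y ->
     series (fun k => par y ^+ k * be k) @ \oo --> f y) ->
  radial (geom_bounded c) x ->
  series (fun k => appell_poly k x * al k) @ \oo --> l ->
  iter h lap f x = l.
Proof.
move=> bel2 fE xc gl.
have fS : sums_to (geom_bounded c) (fun k y => par y ^+ k * be k) f.
  move=> y; rewrite -interior_series_domain // => yc; apply: fE.
  exact: interior_subset yc.
have [_ /(_ x xc) fl] := iter_laplacian_series h
  (dominated_power_series c_gt0 bel2) fS.
apply: (cvg_unique _ _ gl); first exact: norm_hausdorff.
move: fl; set u := fun k : nat => _ => ul.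
(* The first [h.*2] terms are killed, so the Appell partial sums are those of the transformed series
   shifted by [h.*2], and the limit is the same. *)
have -> : series (fun k => appell_poly k x * al k) =
    fun M => series u (M + h.*2)%N.
  apply/funext => M; rewrite /series /= !big_mkord addnC big_split_ord /=.
  rewrite [X in _ = X + _]big1 ?add0r => [|i _]; last first.
    by rewrite /u; exact: (iter_laplacian_term_small (be i) x (ltn_ord i)).
  apply: eq_bigr => i _; rewrite /u addnC iter_laplacian_term al_be //.
suff : (fun M => series u (M + h.*2)%N) @ \oo --> iter h lap f x by [].
by rewrite (cvg_shiftn h.*2 (series u)).
Qed.

Lemma weighted_l2_al : weighted_l2 c be -> weighted_l2 b al.
Proof.
move=> /(weighted_l2P _ c_gt0)[S HS]; apply/(weighted_l2P _ weight_gt0).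
exists ((fueter_const / (h.*2)`!%:R) ^+ 2 * S) => M.
apply: le_trans (ler_wpM2l (sqr_ge0 _) (HS (h.*2 + M)%N)).
rewrite big_split_ord mulrDr; apply: ler_wpDl => /=.
  rewrite mulr_ge0 ?sqr_ge0 // sumr_ge0 // => i _.
  by rewrite mulr_ge0 ?sqr_ge0 // ltW.
rewrite mulr_sumr; apply: ler_sum => i _; rewrite al_be normrZ exprMn.
rewrite real_normK ?num_real // mulrA weight_coef_ratio addnC.
by rewrite mulrAC mulrC mulrA.
Qed.

Lemma weighted_l2_be : (forall k, (k < h.*2)%N -> be k = 0) ->
  weighted_l2 b al -> weighted_l2 c be.
Proof.
move=> be0 /(weighted_l2P _ weight_gt0)[S HS]; apply/(weighted_l2P _ c_gt0).
pose K := (fueter_const / (h.*2)`!%:R) ^+ 2.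
have K0 : 0 < K.
  have z0 : fueter_const / (h.*2)`!%:R != 0.
    by rewrite mulf_neq0 ?invr_neq0 ?fueter_const_neq0.
  by rewrite exprn_even_gt0.
exists (K^-1 * S) => M.
have Kv0 : 0 <= K^-1 by rewrite invr_ge0 ltW.
apply: le_trans (ler_wpM2l Kv0 (HS M)).
apply: (@le_trans _ _ (\sum_(k < h.*2 + M) c k * `|be k| ^+ 2)).
  rewrite addnC big_split_ord lerDl sumr_ge0 // => i _.
  by rewrite mulr_ge0 ?sqr_ge0 // ltW.
rewrite big_split_ord /= big1 ?add0r => [|i _]; last first.
  by rewrite be0 //= normr0 expr0n mulr0.
rewrite mulr_sumr; apply: ler_sum => i _; rewrite al_be normrZ exprMn.
rewrite real_normK ?num_real // [b i * _]mulrA weight_coef_ratio -/K addnC.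
by rewrite le_eqVlt; apply/orP; left; apply/eqP; field; rewrite gt_eqF.
Qed.

End FueterSce.

Unset Implicit Arguments.

Theorem proposition4p4 (R : realType) (n : nat) (n_odd : odd n)
    (c : nat -> R) (c_nondecreasing : nondecreasing_seq c) (c0 : c 0%N = 1)
    (b : nat -> R)
    (bE : forall k, b k =
       c (k + n - 1)%N * (k`!%:R) ^+ 2 / ((n + k - 1)%N`!%:R) ^+ 2) :
  let Oc := interior (series_domain n c) in
  let Ob := interior (series_domain n b) in
  [/\ Oc = Ob,
      forall f, HS n c f -> laplacian_iter_defined (n.-1)./2 Oc f &
      [set fueter_sce f \_ Oc | f in HS n c] = [set g \_ Ob | g in HM n b]].
Proof.
set h := (n.-1)./2; have nE : n = h.*2.+1.
  by rewrite /h -[n in LHS]odd_double_half -[n in RHS]odd_double_half n_odd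
    add1n /= doubleK.
have c_ge1 k : 1 <= c k by rewrite -c0; apply: c_nondecreasing.
have c_gt0 k : 0 < c k by exact: lt_le_trans (c_ge1 k).
have bE' k : b k = c (k + h.*2)%N * (k`!%:R / (k + h.*2)`!%:R) ^+ 2.
  have -> : (k + h.*2 = k + n - 1)%N by rewrite nE addnS subn1.
  by rewrite bE (addnC n) expr_div_n [RHS]mulrA.
have b_gt0 := weight_gt0 c_ge1 bE'.
have OcE := interior_series_domain n c_gt0.
have ObE := interior_series_domain n b_gt0.
have Ocb := radial_weight n c_ge1 bE'.
move=> Oc Ob.
have OO : Oc = Ob by rewrite /Oc /Ob OcE ObE.
split=> //.
- move=> f [be bel2 [fE _]] j i x jh; rewrite /Oc OcE => xc.
  have fS : sums_to (geom_bounded c) (fun k y => paravector y ^+ k * be k) f.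
    by move=> y; rewrite -OcE => yc; apply: fE; exact: interior_subset yc.
  have [[e [C pd]] pS] := iter_laplacian_series j
    (dominated_power_series c_gt0 bel2) fS.
  have [_ _ H] := laplacian_series pd pS; exact: H.
(* Both inclusions reduce to this: coefficient sequences matched by [coef_ratio] and the shift give
   equal functions on the common interior. *)
have fueterE al be f g : (forall j, al j = coef_ratio R n h j *: be (j + h.*2)%N) ->
    weighted_l2 c be ->
    (forall y, series_domain n c y ->
      series (fun k => paravector y ^+ k * be k) @ \oo --> f y) ->
    (forall y, series_domain n b y ->
      series (fun k => appell_poly k y * al k) @ \oo --> g y) ->
    fueter_sce f \_ Oc = g \_ Ob.
  move=> albe bel2 fE gE; apply/funext => x; rewrite OO /patch.
  case: ifPn => // /set_mem xO; apply: (fueter_sce_series nE c_ge1 albe bel2 fE).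
    by rewrite -OcE -/Oc OO.
  by apply: gE; exact: interior_subset xO.
have cvg_HS be y : weighted_l2 c be -> series_domain n c y ->
    cvgn (series (fun k => paravector y ^+ k * be k)).
  move=> bel2 yc.
  apply: (cvg_weighted_series (p := fun k x => paravector x ^+ k) c_gt0 bel2 yc).
  by move=> k; rewrite norm_paravectorX.
have cvg_HM al y : weighted_l2 b al -> series_domain n b y ->
    cvgn (series (fun k => appell_poly k y * al k)).
  move=> all2 yb.
  apply: (cvg_weighted_series (p := @appell_poly R n) b_gt0 all2 yb) => k.
  exact: norm_appell_polyM nE.
apply/seteqP; split=> [_ [f fHS <-]|_ [g gHM <-]].
- have [be bel2 [fE _]] := fHS.
  pose al j := coef_ratio R n h j *: be (j + h.*2)%N.
  have albe j : al j = coef_ratio R n h j *: be (j + h.*2)%N by [].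
  have all2 := weighted_l2_al nE c_ge1 bE' albe bel2.
  (* The default 0 off the domain is the representation that [series_space] prescribes. *)
  pose g y := if y \in series_domain n b
    then lim (series (fun k => appell_poly k y * al k) @ \oo) else 0.
  have gE y : series_domain n b y ->
      series (fun k => appell_poly k y * al k) @ \oo --> g y.
    by move=> yb; rewrite /g mem_set //; exact: cvg_HM.
  exists g; last by apply/esym; exact: fueterE albe bel2 fE gE.
  exists al => //; split=> // x xb; rewrite /g memNset //.
- have [al all2 [gE _]] := gHM.
  (* The coefficients below [h.*2] do not affect the image; the value 0 keeps them out of the
     weighted sum for c, and the others invert [coef_ratio]. *)
  pose be k := if (k < h.*2)%N then 0
    else (coef_ratio R n h (k - h.*2))^-1 *: al (k - h.*2)%N.
  have albe j : al j = coef_ratio R n h j *: be (j + h.*2)%N.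
    rewrite /be ltnNge leq_addl /= addnK scalerA mulfV ?scale1r //.
    exact: coef_ratio_neq0.
  have be0 k : (k < h.*2)%N -> be k = 0 by rewrite /be => ->.
  have bel2 := weighted_l2_be nE c_ge1 bE' albe be0 all2.
  pose f y := if y \in series_domain n c
    then lim (series (fun k => paravector y ^+ k * be k) @ \oo) else 0.
  have fE y : series_domain n c y ->
      series (fun k => paravector y ^+ k * be k) @ \oo --> f y.
    by move=> yc; rewrite /f mem_set //; exact: cvg_HS.
  exists f; last exact: fueterE albe bel2 fE gE.
  exists be => //; split=> // x xc; rewrite /f memNset //.
Qed.
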